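(* Let $C$ and $D$ be nonempty closed semi-algebraic sets in $\mathbb{R}^n$, with $C$ convex. Suppose that $0<\gamma<\sqrt{\frac32}-1$ and that either $C$ or $D$ is compact. Let $\{(y^t,z^t,x^t)\}_{t\ge1}$ be any sequence generated by the Douglas-Rachford splitting method for the feasibility problem (defined in the context) with step-size parameter $\gamma$ from an initial point $x^0\in\mathbb{R}^n$. Then the sequence $\{(y^t,z^t,x^t)\}$ converges to a point $(y^*,z^*,x^* )$ which satisfies $z^*=y^*$, and $z^*$ is a stationary point of the problem $\min_{u\in D}\frac12d_C^2(u)$.
   Context: $d_C(u)=\inf_{c\in C}\|u-c\|$ and $P_C$ is the projection onto the closed convex set $C$. Douglas-Rachford splitting method for the feasibility problem. Given $x^0\in\mathbb{R}^n$ and $\gamma>0$, for $t=0,1,2,\dots$ set/choose $$y^{t+1}=\frac1{1+\gamma}\big(x^t+\gamma P_C(x^t)\big),\quad z^{t+1}\in\operatorname{Arg\,min}_{z\in D}\|2y^{t+1}-x^t-z\|^2,\quad x^{t+1}=x^t+(z^{t+1}-y^{t+1}).$$ Semi-algebraic. A set $S\subseteq\mathbb{R}^n$ is semi-algebraic if it is a finite union of sets of the form $\{x: h_1(x)=\dots=h_k(x)=0,\ g_1(x)<0,\dots,g_r(x)<0\}$ with real polynomials $h_i,g_j$. Stationarity. A point $z^*\in D$ is a stationary point of $\min_{u\in D}\frac12d_C^2(u)$ if $0\in z^*-P_C(z^* )+N_D(z^* )$ (note $\nabla(\frac12d_C^2)(u)=u-P_C(u)$). Here $N_D(x)=\partial\delta_D(x)$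 is the limiting normal cone of $D$ at $x\in D$, where $\delta_D$ is the indicator function of $D$ ($0$ on $D$, $+\infty$ elsewhere) and $\partial$ is the limiting subdifferential; equivalently, $v\in N_D(x)$ iff there exist $x^k\in D$, $x^k\to x$, $v^k\to v$ with $\limsup_{z\to x^k,\,z\in D,\,z\ne x^k}\frac{\langle v^k,z-x^k\rangle}{\|z-x^k\|}\le0$ for each $k$. *)

(* Defs.v *)
(* [mpoly] is not imported because its notations clash with those of
   MathComp-Analysis. *)
From mathcomp Require Import all_boot all_order all_algebra.
From mathcomp Require Import all_classical all_reals all_analysis.
From mathcomp Require mpoly.

Set Implicit Arguments.
Unset Strict Implicit.
Unset Printing Implicit Defensive.

Import Order.TTheory GRing.Theory Num.Theory.
Import numFieldNormedType.Exports.

Local Open Scope classical_set_scope.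
Local Open Scope ring_scope.

(* The library norm [`|u|] on ['rV[R]_n] is the sup norm; it induces the same
   topology as [enorm], but projections and normal cones need the Euclidean
   structure. *)
Definition dot (R : realType) (n : nat) (u v : 'rV[R]_n) : R :=
  \sum_(i < n) u 0 i * v 0 i.

Definition enorm (R : realType) (n : nat) (u : 'rV[R]_n) : R :=
  Num.sqrt (dot u u).

Definition semialgebraic (R : realType) (n : nat) (S : set 'rV[R]_n) : Prop :=
  exists F : seq (seq (mpoly.mpoly n R) * seq (mpoly.mpoly n R)),
    S = [set x : 'rV[R]_n |
          has (fun hg => all (fun h => mpoly.meval (fun i => x 0 i) h == 0) hg.1 &&
                         all (fun g => mpoly.meval (fun i => x 0 i) g < 0) hg.2) F].

Definition dist (R : realType) (n : nat) (C : set 'rV[R]_n) (u : 'rV[R]_n) : R :=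
  inf [set enorm (u - c) | c in C].

(* The point of [C] at distance [dist C u] from [u]; it exists and is unique
   when [C] is nonempty, closed and convex.  The value is [0] when there is no
   such point. *)
Definition proj (R : realType) (n : nat) (C : set 'rV[R]_n) (u : 'rV[R]_n) :
    'rV[R]_n :=
  xget 0 [set p | C p /\ enorm (u - p) = dist C u].

Definition argmin (T : Type) (R : realType) (A : set T) (f : T -> R) : set T :=
  [set z | A z /\ forall w, A w -> f z <= f w].

Section Subdifferential.
Local Open Scope ereal_scope.

(* Frechet subdifferential:
   liminf_{z -> x, z <> x} (f z - f x - <v, z - x>) / ||z - x|| >= 0. *)
Definition frechet_subdiff (R : realType) (n : nat) (f : 'rV[R]_n -> \bar R)
    (x : 'rV[R]_n) : set 'rV[R]_n :=
  [set v | f x \is a fin_num /\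
     0 <= limf_einf (fun z => (f z - f x - (dot v (z - x)%R)%:E) *
                              ((enorm (z - x)%R)^-1)%:E) x^'].

Definition limiting_subdiff (R : realType) (n : nat) (f : 'rV[R]_n -> \bar R)
    (x : 'rV[R]_n) : set 'rV[R]_n :=
  [set v | f x \is a fin_num /\
     exists xs vs : nat -> 'rV[R]_n,
       [/\ xs @ \oo --> x, (fun k => f (xs k)) @ \oo --> f x,
           vs @ \oo --> v & forall k, frechet_subdiff f (xs k) (vs k)]].

(* The indicator in the sense of convex analysis: 0 on [D], +oo elsewhere. *)
Definition indicator (R : realType) (n : nat) (D : set 'rV[R]_n)
    (x : 'rV[R]_n) : \bar R :=
  if `[< D x >] then 0 else +oo.

Definition normal_cone (R : realType) (n : nat) (D : set 'rV[R]_n)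
    (x : 'rV[R]_n) : set 'rV[R]_n :=
  limiting_subdiff (indicator D) x.

End Subdifferential.

(* First-order stationarity for the problem min_{u in D} (dist C u)^2 / 2, the
   gradient of the objective at [z] being [z - proj C z]. *)
Definition stationary (R : realType) (n : nat) (C D : set 'rV[R]_n)
    (z : 'rV[R]_n) : Prop :=
  D z /\ exists2 v, normal_cone D z v & 0 = z - proj C z + v.

(* [y 0] and [z 0] are not constrained: these sequences start at index 1. *)
Definition DR_sequence (R : realType) (n : nat) (C D : set 'rV[R]_n)
    (gamma : R) (x0 : 'rV[R]_n) (y z x : nat -> 'rV[R]_n) : Prop :=
  x 0%N = x0 /\
  forall t, [/\
    y t.+1 = (1 + gamma)^-1 *: (x t + gamma *: proj C (x t)),
    argmin D (fun w => enorm (2 *: y t.+1 - x t - w) ^+ 2) (z t.+1) &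
    x t.+1 = x t + (z t.+1 - y t.+1)].

(* Main.v *)
From mathcomp Require Import all_boot all_order all_algebra.
From mathcomp Require Import all_classical all_reals all_analysis.
From mathcomp Require mpoly.
From mathcomp.real_closed Require ordered_qelim qe_rcf.
From mathcomp Require Import lra ring.
Require Import Defs.

(** Let p be the projection of the current point x of the method, and y, z
the iterates computed from it, so that x = y + gamma (y - p).  The argument
follows the function
   merit p z y = gamma |z - p|^2 + (1 - gamma) |z - y|^2
on C x D x R^n, along the triples (p, z, y).  It is 2 gamma times the usual
Douglas-Rachford merit function, in which the distance to C has been traded for
an explicit point p of C: it is a polynomial on a closed semialgebraic set.

Let d = |z - y|, which is also the length of the step made by x.  At each step
the merit drops by at least a d^2 for a constant a > 0 ([merit_decrease]), and
the merit of a competitor at distance r from the iterate is at least that of the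
iterate minus (2 d r + r^2) ([merit_slope]): p and z are nearest points, and the
first order terms that they contribute cancel up to a multiple of z - y.
The Kurdyka-Lojasiewicz inequality ([kurdyka_inequality]) bounds the drop of the
merit from level s to level s' by the slope times V s - V s', for a bounded
nondecreasing V.  Hence a d^2 <= s - s' <= 2 d (V s - V s'), so that d is
dominated by differences of a bounded monotone sequence and is summable
([kl_summable]).  The sequences x and p have finite length, hence converge; y
and z then have the same limit, and the proximal normals carried by the
iterates z converge to a limiting normal of D there.

For the inequality itself, let B s be the set of pairs (rho, w) where w lies on
the level s and rho bounds the slope at w.  Minimizing lexicographically selects
from B s the least slope rho s, and a point w s, as definable functions of s
([definable_selection]).  Definable functions of one variable are continuous and
monotone near 0 ([definable_tame]), so that the curve w, which is bounded, has
finite length; its arc length in the l1 norm is V.  Two points u < v of the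
curve satisfy
   v - u <= rho v |w v - w u| + L |w v - w u|^2,
and, by continuity, the quadratic term disappears when the interval is
subdivided ([talweg_le]).

Monotonicity is deduced from quantifier elimination, which makes a definable
predicate of one real variable eventually true or eventually false at 0+
([definable_germ]).  Whether a function increases or decreases just to the right
and just to the left of s is then eventually independent of s.  The mixed cases
would make every s a local extremum that is strict on one side of s, and there
are only countably many; a similar count excludes a monotone function with a
jump at every point. *)

Set Implicit Arguments.
Unset Strict Implicit.
Unset Printing Implicit Defensive.

Import Order.TTheory GRing.Theory Num.Theory.
Import numFieldNormedType.Exports.
Import ordered_qelim.

Local Open Scope classical_set_scope.
Local Open Scope ring_scope.

(** * First-order definable sets over the reals *)

(** A type of points described by [ncoords] real coordinates.  Formulas speak of
points through [coords_of]; surjectivity turns a quantifier over the type into a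
block of real quantifiers. *)
Class coords (R : realType) (E : Type) := Coords {
  ncoords : nat;
  coords_of : E -> seq R;
  size_coords : forall e, size (coords_of e) = ncoords;
  coords_surj : forall l, size l = ncoords -> exists e, coords_of e = l }.

Section Instances.
Variable R : realType.

#[global] Instance coords_scalar : coords R R.
Proof.
exists 1%N (fun x => [:: x]) => // l.
by case: l => [|x []] // _; exists x.
Defined.

#[global] Instance coords_prod (E F : Type) (cE : coords R E)
    (cF : coords R F) : coords R (E * F)%type.
Proof.
exists (@ncoords _ _ cE + @ncoords _ _ cF)%N (fun p => coords_of p.1 ++ coords_of p.2).
  by move=> e; rewrite size_cat !size_coords.
move=> l lE.
have [e eE] : exists e : E, coords_of e = take (@ncoords _ _ cE) l.
  by apply: coords_surj; rewrite size_takel ?lE ?leq_addr.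
have [f fE] : exists f : F, coords_of f = drop (@ncoords _ _ cE) l.
  by apply: coords_surj; rewrite size_drop lE addKn.
by exists (e, f); rewrite /= eE fE cat_take_drop.
Defined.

#[global] Instance coords_row (n : nat) : coords R 'rV[R]_n.
Proof.
exists n (fun v : 'rV_n => [seq v 0 i | i <- enum 'I_n]).
  by move=> v; rewrite size_map size_enum_ord.
move=> l lE; exists (\row_i l`_i); apply: (@eq_from_nth _ 0).
  by rewrite size_map size_enum_ord.
move=> i; rewrite size_map size_enum_ord => iN.
by rewrite (nth_map (Ordinal iN)) ?size_enum_ord// mxE nth_enum_ord.
Defined.

End Instances.

Section FirstOrder.
Variable R : realType.
Implicit Types (E F G : Type).
Local Notation term := (GRing.term R).
Local Notation formula := (ord.formula R).

Fixpoint tinst (s : nat -> term) (t : term) : term :=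
  match t with
  | GRing.Var i => s i
  | GRing.Const _ | GRing.NatConst _ => t
  | GRing.Add t1 t2 => GRing.Add (tinst s t1) (tinst s t2)
  | GRing.Opp t1 => GRing.Opp (tinst s t1)
  | GRing.NatMul t1 k => GRing.NatMul (tinst s t1) k
  | GRing.Mul t1 t2 => GRing.Mul (tinst s t1) (tinst s t2)
  | GRing.Inv t1 => GRing.Inv (tinst s t1)
  | GRing.Exp t1 k => GRing.Exp (tinst s t1) k
  end.

Lemma eval_tinst s e l t : (forall i, GRing.eval e (s i) = l`_i) ->
  GRing.eval e (tinst s t) = GRing.eval l t.
Proof.
move=> sE; elim: t => //=.
- by move=> t1 -> t2 ->.
- by move=> t1 ->.
- by move=> t1 -> k.
- by move=> t1 -> t2 ->.
- by move=> t1 ->.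
- by move=> t1 -> k.
Qed.

(** Binders are left alone, as this is used on quantifier-free formulas only. *)
Fixpoint finst (s : nat -> term) (f : formula) : formula :=
  match f with
  | ord.Bool _ => f
  | ord.Equal t1 t2 => ord.Equal (tinst s t1) (tinst s t2)
  | ord.Lt t1 t2 => ord.Lt (tinst s t1) (tinst s t2)
  | ord.Le t1 t2 => ord.Le (tinst s t1) (tinst s t2)
  | ord.Unit t1 => ord.Unit (tinst s t1)
  | ord.And f1 f2 => ord.And (finst s f1) (finst s f2)
  | ord.Or f1 f2 => ord.Or (finst s f1) (finst s f2)
  | ord.Implies f1 f2 => ord.Implies (finst s f1) (finst s f2)
  | ord.Not f1 => ord.Not (finst s f1)
  | ord.Exists i f1 => ord.Exists i f1
  | ord.Forall i f1 => ord.Forall i f1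
  end.

(** Without quantifiers there is no capture to avoid; this is why inverse images
of definable sets are taken after quantifier elimination. *)
Lemma holds_finst s e l f : (forall i, GRing.eval e (s i) = l`_i) ->
  ord.qf_form f -> (ord.holds e (finst s f) <-> ord.holds l f).
Proof.
move=> sE; elim: f => //=.
- by move=> t1 t2 _; rewrite !(eval_tinst _ sE).
- by move=> t1 t2 _; rewrite !(eval_tinst _ sE).
- by move=> t1 t2 _; rewrite !(eval_tinst _ sE).
- by move=> t1 _; rewrite !(eval_tinst _ sE).
- by move=> f1 h1 f2 h2 /andP[/h1 -> /h2 ->].
- by move=> f1 h1 f2 h2 /andP[/h1 -> /h2 ->].
- by move=> f1 h1 f2 h2 /andP[/h1 -> /h2 ->].
- by move=> f1 h1 /h1 ->.
Qed.

(** Tarski-Seidenberg. *)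
Lemma holds_qf (f : formula) : exists g : formula,
  [/\ ord.qf_form g, ord.rformula g & forall e, ord.holds e f <-> ord.holds e g].
Proof.
pose rf := ord.to_rform f; have rfP := ord.to_rform_rformula f.
pose g := ord.quantifier_elim
    (fun n s => qe_rcf.qfr_to_formula (@qe_rcf.wproj R n s)) rf.
have /andP[gqf gr] := ord.quantifier_elim_wf (@qe_rcf.wf_QE_wproj R) rfP.
exists g; split=> // e.
rewrite -ord.to_rformP.
have fP := ord.quantifier_elim_rformP (@qe_rcf.wf_QE_wproj R)
  (@qe_rcf.valid_QE_wproj R) e rfP.
have gP := ord.qf_evalP e gqf.
by split=> [/fP/gP//|/gP/fP].
Qed.

(** The coordinates of the quantified point come after those of the context,
which is the order of [coords_prod]. *)
Lemma holds_exists (f : formula) k e :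
  ord.holds e (foldr ord.Exists f (iota (size e) k)) <->
  exists2 l, size l = k & ord.holds (e ++ l) f.
Proof.
elim: k e => [|k ih] e /=.
  split=> [h|[l /size0nil ->]]; last by rewrite cats0.
  by exists [::] => //; rewrite cats0.
have sE x : set_nth 0 e (size e) x = rcons e x.
  by elim: e {ih} => //= a e ->.
split=> [[x]|[[|x l] //= [lk] h]].
  rewrite sE -(size_rcons e x) => /ih[l lk h].
  by exists (x :: l); rewrite /= ?lk// -cat_rcons.
by exists x; rewrite sE -(size_rcons e x); apply/ih; exists l; rewrite ?cat_rcons.
Qed.

Definition definable E {cE : coords R E} (P : E -> Prop) : Prop :=
  exists f : formula, forall e, P e <-> ord.holds (coords_of e) f.

(** The terms may contain inverses, which quantifier elimination removes; only
polynomial maps occur below. *)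
Definition polymap E {cE : coords R E} F {cF : coords R F} (g : E -> F) : Prop :=
  forall i, exists t : term, forall e, (coords_of (g e))`_i = GRing.eval (coords_of e) t.

Section Closure.
Context {E : Type} {cE : coords R E}.
Implicit Types P Q : E -> Prop.

Lemma definable_ext P Q : (forall e, P e <-> Q e) -> definable P -> definable Q.
Proof. by move=> PQ [f fP]; exists f => e; rewrite -PQ. Qed.

Lemma definable_cst (p : Prop) : definable (fun _ : E => p).
Proof. by exists (ord.Bool `[< p >]) => e; split => [/asboolP|/= /asboolP]. Qed.

Lemma definable_and P Q : definable P -> definable Q ->
  definable (fun e => P e /\ Q e).
Proof. by move=> [f fP] [g gP]; exists (ord.And f g) => e; rewrite fP gP. Qed.

Lemma definable_or P Q : definable P -> definable Q ->
  definable (fun e => P e \/ Q e).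
Proof. by move=> [f fP] [g gP]; exists (ord.Or f g) => e; rewrite fP gP. Qed.

Lemma definable_imp P Q : definable P -> definable Q ->
  definable (fun e => P e -> Q e).
Proof. by move=> [f fP] [g gP]; exists (ord.Implies f g) => e; rewrite fP gP. Qed.

Lemma definable_not P : definable P -> definable (fun e => ~ P e).
Proof. by move=> [f fP]; exists (ord.Not f) => e; rewrite fP. Qed.

Lemma definable_ex {F : Type} {cF : coords R F} (P : E -> F -> Prop) :
  definable (fun p => P p.1 p.2) -> definable (fun e => exists x, P e x).
Proof.
move=> [f fP]; exists (foldr ord.Exists f (iota (@ncoords _ _ cE) (@ncoords _ _ cF))).
move=> e; rewrite -(size_coords e) holds_exists; split.
  by move=> [x Pex]; exists (coords_of x); rewrite ?size_coords//; apply: (fP (e, x)).1.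
by move=> [l /coords_surj[x <-] h]; exists x; apply: (fP (e, x)).2.
Qed.

(** A quantifier-free description of [P] can be instantiated by the terms of
[g]. *)
Lemma definable_comp {F : Type} {cF : coords R F} (P : F -> Prop) (g : E -> F) :
  definable P -> polymap g -> definable (fun e => P (g e)).
Proof.
move=> [f fP] /choice[s sE]; have [h [hqf _ hP]] := holds_qf f.
exists (finst s h) => e; rewrite fP hP.
by rewrite (@holds_finst s (coords_of e) (coords_of (g e))).
Qed.

End Closure.

Lemma definable_all {E F : Type} {cE : coords R E} {cF : coords R F}
    (P : E -> F -> Prop) :
  definable (fun p => P p.1 p.2) -> definable (fun e => forall x, P e x).
Proof.
move=> dP; apply: (@definable_ext _ _ (fun e => ~ exists x, ~ P e x)).
  by move=> e; rewrite -forallNE; split=> h x; have := h x; rewrite notK.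
apply: definable_not; apply: (@definable_ex _ _ _ _ (fun e x => ~ P e x)).
exact: definable_not.
Qed.

Lemma polymap_id {E : Type} {cE : coords R E} : polymap (fun e : E => e).
Proof. by move=> i; exists (GRing.Var R i). Qed.

Section PolymapProd.
Context {E F G : Type} {cE : coords R E} {cF : coords R F} {cG : coords R G}.

Lemma polymap_fst (g : E -> F * G) : polymap g -> polymap (fun e => (g e).1).
Proof.
move=> pg i; have [iF|iF] := ltnP i (@ncoords _ _ cF); last first.
  by exists (GRing.Const 0) => e; rewrite nth_default// size_coords.
have [t tE] := pg i; exists t => e; rewrite -tE/=.
by rewrite nth_cat size_coords iF.
Qed.

Lemma polymap_snd (g : E -> F * G) : polymap g -> polymap (fun e => (g e).2).
Proof.
move=> pg i; have [t tE] := pg (@ncoords _ _ cF + i)%N; exists t => e.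
by rewrite -tE/= nth_cat size_coords ltnNge leq_addr/= addKn.
Qed.

Lemma polymap_pair (g : E -> F) (h : E -> G) :
  polymap g -> polymap h -> polymap (fun e => (g e, h e)).
Proof.
move=> pg ph i; have [iF|iF] := ltnP i (@ncoords _ _ cF).
  by have [t tE] := pg i; exists t => e; rewrite -tE /= nth_cat size_coords iF.
have [t tE] := ph (i - @ncoords _ _ cF)%N; exists t => e.
by rewrite -tE /= nth_cat size_coords ltnNge iF.
Qed.

End PolymapProd.

Lemma polymap_comp {E F G : Type} {cE : coords R E} {cF : coords R F}
    {cG : coords R G} (g : F -> G) (f : E -> F) :
  polymap g -> polymap f -> polymap (fun e => g (f e)).
Proof.
move=> pg /choice[s sE] i; have [t tE] := pg i.
exists (tinst s t) => e; rewrite tE; symmetry; exact: eval_tinst.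
Qed.

Section PolymapReal.
Context {E : Type} {cE : coords R E}.
Implicit Types g h : E -> R.

Lemma polymapP g :
  polymap g <-> exists t : term, forall e, g e = GRing.eval (coords_of e) t.
Proof.
split=> [/(_ 0%N)//|[t tE] [|i]]; first by exists t.
by exists (GRing.Const 0) => e /=; rewrite nth_nil.
Qed.

Lemma polymap_cst (a : R) : polymap (fun _ : E => a).
Proof. by apply/polymapP; exists (GRing.Const a). Qed.

Lemma polymapD g h : polymap g -> polymap h -> polymap (fun e => g e + h e).
Proof.
move=> /polymapP[t tE] /polymapP[u uE]; apply/polymapP.
by exists (GRing.Add t u) => e /=; rewrite tE uE.
Qed.

Lemma polymapN g : polymap g -> polymap (fun e => - g e).
Proof.
by move=> /polymapP[t tE]; apply/polymapP; exists (GRing.Opp t) => e /=; rewrite tE.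
Qed.

Lemma polymapM g h : polymap g -> polymap h -> polymap (fun e => g e * h e).
Proof.
move=> /polymapP[t tE] /polymapP[u uE]; apply/polymapP.
by exists (GRing.Mul t u) => e /=; rewrite tE uE.
Qed.

Lemma polymapX g k : polymap g -> polymap (fun e => g e ^+ k).
Proof.
by move=> /polymapP[t tE]; apply/polymapP; exists (GRing.Exp t k) => e /=; rewrite tE.
Qed.

Lemma polymap_sum I (r : seq I) (g : I -> E -> R) :
  (forall i, polymap (g i)) -> polymap (fun e => \sum_(i <- r) g i e).
Proof.
move=> pg; elim: r => [|i r ih].
  by under eq_fun do rewrite big_nil; exact: polymap_cst.
by under eq_fun do rewrite big_cons; exact: polymapD.
Qed.

Lemma polymap_prod I (r : seq I) (g : I -> E -> R) :
  (forall i, polymap (g i)) -> polymap (fun e => \prod_(i <- r) g i e).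
Proof.
move=> pg; elim: r => [|i r ih].
  by under eq_fun do rewrite big_nil; exact: polymap_cst.
by under eq_fun do rewrite big_cons; exact: polymapM.
Qed.

Lemma definable_lt g h : polymap g -> polymap h -> definable (fun e => g e < h e).
Proof.
by move=> /polymapP[t tE] /polymapP[u uE]; exists (ord.Lt t u) => e; rewrite tE uE.
Qed.

Lemma definable_le g h : polymap g -> polymap h -> definable (fun e => g e <= h e).
Proof.
by move=> /polymapP[t tE] /polymapP[u uE]; exists (ord.Le t u) => e; rewrite tE uE.
Qed.

Lemma definable_eq g h : polymap g -> polymap h -> definable (fun e => g e = h e).
Proof.
by move=> /polymapP[t tE] /polymapP[u uE]; exists (ord.Equal t u) => e; rewrite tE uE.
Qed.

Lemma polymap_row (n : nat) (g : E -> 'rV[R]_n) :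
  polymap g <-> forall i, polymap (fun e => g e 0 i).
Proof.
split=> pg i.
  have [t tE] := pg i; apply/polymapP; exists t => e; rewrite -tE /=.
  by rewrite (nth_map i) ?size_enum_ord// nth_ord_enum.
have [iN|iN] := ltnP i n; last first.
  exists (GRing.Const 0) => e; rewrite nth_default//=.
  by rewrite size_map size_enum_ord.
have /polymapP[t tE] := pg (Ordinal iN); exists t => e; rewrite -tE /=.
by rewrite (nth_map (Ordinal iN)) ?size_enum_ord// -[i]/(val (Ordinal iN)) nth_ord_enum.
Qed.

End PolymapReal.

End FirstOrder.

(** * Germs at zero of definable predicates *)

Section Germs.
Variable R : realType.

(** By induction on the polynomial p X + c: the sign near 0 is that of c if c is not
zero, and that of p otherwise. *)
Lemma poly_germ (p : {poly R}) :
  [\/ \forall s \near 0^'+, p.[s] = 0, \forall s \near 0^'+, 0 < p.[s]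
    | \forall s \near 0^'+, p.[s] < 0].
Proof.
elim/poly_ind: p => [|p c ih].
  by constructor 1; near=> s; rewrite horner0.
have pc : (p * 'X + c%:P).[s] @[s --> 0^'+] --> c.
  rewrite -[X in _ --> X](_ : (p * 'X + c%:P).[0] = c); last first.
    by rewrite hornerMXaddC mulr0 add0r.
  by apply: cvg_at_right_filter; exact: continuous_horner.
have [c0|c0|c0] := ltgtP c 0.
- by constructor 3; exact: (cvgr_lt c pc).
- by constructor 2; exact: (cvgr_gt c pc).
- case: ih => ih; [constructor 1|constructor 2|constructor 3]; near=> s;
    rewrite hornerMXaddC c0 addr0.
  + by rewrite (near ih s)// mul0r.
  + by rewrite mulr_gt0//; near: s; first [exact: ih | exact: nbhs_right_gt].
  + by rewrite nmulr_rlt0//; near: s; first [exact: ih | exact: nbhs_right_gt].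
Unshelve. all: by end_near. Qed.

Lemma eval_rterm_poly (t : GRing.term R) : GRing.rterm t ->
  exists p : {poly R}, forall s, GRing.eval [:: s] t = p.[s].
Proof.
elim: t => //=.
- move=> [|i] _; first by exists 'X => s; rewrite hornerX.
  by exists 0 => s; rewrite horner0; case: i.
- by move=> a _; exists a%:P => s; rewrite hornerC.
- by move=> k _; exists (k%:R)%:P => s; rewrite hornerC.
- move=> t iht u ihu /andP[/iht[p pE] /ihu[q qE]].
  by exists (p + q) => s; rewrite hornerD pE qE.
- by move=> t iht /iht[p pE]; exists (- p) => s; rewrite hornerN pE.
- by move=> t iht k /iht[p pE]; exists (p *+ k) => s; rewrite hornerMn pE.
- move=> t iht u ihu /andP[/iht[p pE] /ihu[q qE]].
  by exists (p * q) => s; rewrite hornerM pE qE.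
- by move=> t iht k /iht[p pE]; exists (p ^+ k) => s; rewrite horner_exp pE.
Qed.

(** This is all the o-minimality used below.  After quantifier elimination the
atoms compare polynomials in s, whose signs are constant just after 0. *)
Lemma definable_germ (P : R -> Prop) : definable P ->
  (\forall s \near 0^'+, P s) \/ (\forall s \near 0^'+, ~ P s).
Proof.
move=> [f0 fP]; have [f [fqf fr f0f]] := holds_qf f0.
suff : (\forall s \near 0^'+, ord.holds [:: s] f) \/
       (\forall s \near 0^'+, ~ ord.holds [:: s] f).
  by case=> h; [left|right]; near=> s; rewrite fP f0f /=; near: s.
have atom (t u : GRing.term R) : GRing.rterm t -> GRing.rterm u ->
    [\/ \forall s \near 0^'+, GRing.eval [:: s] t = GRing.eval [:: s] u,
        \forall s \near 0^'+, GRing.eval [:: s] t < GRing.eval [:: s] u |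
        \forall s \near 0^'+, GRing.eval [:: s] t > GRing.eval [:: s] u].
  move=> /eval_rterm_poly[p pE] /eval_rterm_poly[q qE].
  have [h|h|h] := poly_germ (q - p); [constructor 1|constructor 2|constructor 3];
    near=> s; rewrite pE qE; have := near h s; rewrite hornerD hornerN.
  + by move=> /(_ _)/subr0_eq->.
  + by rewrite subr_gt0; apply.
  + by rewrite subr_lt0; apply.
elim: f fqf fr {f0f fP} => //=.
- by move=> b _ _; case: b; [left|right]; near=> s.
- move=> t u _ /andP[rt ru].
  have [h|h|h] := atom t u rt ru; [left|right|right]; near=> s.
  + by near: s.
  + by apply/eqP; rewrite lt_eqF//; near: s.
  + by apply/eqP; rewrite gt_eqF//; near: s.
- move=> t u _ /andP[rt ru].
  have [h|h|h] := atom t u rt ru; [right|left|right]; near=> s => //.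
  + by rewrite (near h s)// ltxx.
  + by near: s.
  + by apply/negP; rewrite -leNgt ltW//; near: s.
- move=> t u _ /andP[rt ru].
  have [h|h|h] := atom t u rt ru; [left|left|right]; near=> s => //.
  + by rewrite (near h s)// lexx.
  + by rewrite ltW//; near: s.
  + by apply/negP; rewrite -ltNge//; near: s.
- move=> f hf g hg /andP[/hf{}hf /hg{}hg] /andP[/hf{}hf /hg{}hg].
  case: hf => hf; last by right; near=> s; move=> [fs _]; move: fs; near: s.
  case: hg => hg; last by right; near=> s; move=> [_ fs]; move: fs; near: s.
  by left; near=> s; split; near: s.
- move=> f hf g hg /andP[/hf{}hf /hg{}hg] /andP[/hf{}hf /hg{}hg].
  case: hf => hf; first by left; near=> s; left; near: s.
  case: hg => hg; first by left; near=> s; right; near: s.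
  by right; near=> s; case; near: s.
- move=> f hf g hg /andP[/hf{}hf /hg{}hg] /andP[/hf{}hf /hg{}hg].
  case: hf => hf; last by left; near=> s => fs; exfalso; move: fs; near: s.
  case: hg => hg; first by left; near=> s => _; near: s.
  right; near=> s => fg.
  have ng : ~ ord.holds [:: s] g by near: s; exact: hg.
  by apply: ng; apply: fg; near: s; exact: hf.
- move=> f hf /hf{}hf /hf{}hf.
  case: hf => hf; [right|left] => //.
  by near=> s => fs; apply: fs; near: s.
Unshelve. all: by end_near. Qed.

End Germs.

(** * Monotonicity of definable functions of one variable *)

Ltac polymap_tac := repeat first
  [ assumption | exact: polymap_id | exact: polymap_cst
  | refine (polymap_fst _) | refine (polymap_snd _) | refine (polymap_pair _ _)
  | refine (polymapD _ _) | refine (polymapN _) | refine (polymapM _ _)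
  | refine (polymapX _ _) ].

Ltac definable_tac := repeat (cbv beta; first
  [ assumption | refine (definable_and _ _) | refine (definable_or _ _)
  | refine (definable_not _) | refine (definable_imp _ _)
  | refine (definable_ex _) | refine (definable_all _)
  | solve [refine (definable_lt _ _); polymap_tac]
  | solve [refine (definable_le _ _); polymap_tac]
  | solve [refine (definable_eq _ _); polymap_tac] ]).

Section Monotonicity.
Variable R : realType.
Implicit Types (g : R -> R) (s t h d : R).

Definition definable_fun g := definable (fun p : R * R => p.2 = g p.1).

(** Terms contain no definable function, so g (f e) is named by a quantified
variable v first. *)
Lemma definable_fun_subst E (cE : coords R E) g (f : E -> R) (Q : E -> R -> Prop) :
  definable_fun g -> polymap f -> definable (fun p => Q p.1 p.2) ->
  definable (fun e => Q e (g (f e))).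
Proof.
move=> dg pf dQ.
apply: (@definable_ext _ _ _ (fun e => exists v, v = g (f e) /\ Q e v)).
  by move=> e; split=> [[v [->]]|] //; exists (g (f e)).
definable_tac.
refine (@definable_comp _ _ _ _ _ (fun p : R * R => p.2 = g p.1)
  (fun p : E * R => (f p.1, p.2)) dg _).
by apply: polymap_pair; [apply: (polymap_comp pf)|]; polymap_tac.
Qed.

Lemma definable_fun_le E (cE : coords R E) g (f1 f2 : E -> R) :
  definable_fun g -> polymap f1 -> polymap f2 ->
  definable (fun e => g (f1 e) <= g (f2 e)).
Proof.
move=> dg p1 p2.
apply: (definable_fun_subst (Q := fun e v => v <= g (f2 e))) => //.
apply: (definable_fun_subst (Q := fun (e : E * R) v => e.2 <= v)) => //.
  by apply: (polymap_comp p2); polymap_tac.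
by definable_tac.
Qed.

Lemma near0P (P : R -> Prop) :
  (\forall s \near 0^'+, P s) <-> (exists2 e, 0 < e & forall s, 0 < s < e -> P s).
Proof.
split.
  move=> [e /= e0 he]; exists e => // s /andP[s0 se]; apply: he => //=.
  by rewrite /ball_/= sub0r normrN gtr0_norm.
move=> [e e0 he]; exists e => //= s; rewrite /ball_/= sub0r normrN => se s0.
by apply: he; rewrite s0/= (le_lt_trans (ler_norm s)).
Qed.

(** Consider the supremum of the u in [s, t] such that g stays above g s on
[s, u]: the left condition shows that it is attained, the right one that it is
not smaller than t. *)
Lemma loc_nondecreasing g a b :
  (forall s, a < s < b -> (exists2 d, 0 < d & forall h, 0 < h < d -> g s <= g (s + h))
     /\ (exists2 d, 0 < d & forall h, 0 < h < d -> g (s - h) <= g s)) ->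
  forall s t, a < s -> s <= t -> t < b -> g s <= g t.
Proof.
move=> hg s t sa st tb.
pose X := [set u | s <= u <= t /\ forall v, s <= v <= u -> g s <= g v].
have Xs : X s.
  by split; [rewrite lexx st | move=> v /andP[? ?]; have -> : v = s by lra].
have supX : has_sup X.
  by split; [exists s | exists t => u [/andP[]]].
pose c := sup X.
have sc : s <= c by apply: ub_le_sup => //; case: supX.
have ct : c <= t by apply: ge_sup; [exists s | move=> u [/andP[]]].
have cab : a < c < b by apply/andP; split; lra.
have below v : s <= v < c -> g s <= g v.
  move=> /andP[sv vc].
  have [u [_ Xu] vu] := sup_adherent (ltac:(lra) : 0 < c - v) supX.
  by apply: Xu; rewrite sv; move: vu; rewrite -/c; lra.
have [[dR dR0 hR] [dL dL0 hL]] := hg c cab.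
have sgc : g s <= g c.
  have [<-//|sc'] := eqVneq s c.
  have sltc : s < c by rewrite lt_neqAle sc'.
  pose h := Num.min (dL / 2) (c - s).
  have h0 : 0 < h by rewrite lt_min; apply/andP; split; lra.
  have hd : h < dL by rewrite gt_min; apply/orP; left; lra.
  have hcs : h <= c - s by rewrite ge_min lexx orbT.
  apply: le_trans (hL h _); last by rewrite h0.
  by apply: below; apply/andP; split; lra.
have [ctE|ct'] := eqVneq c t; first by rewrite -ctE.
have cltt : c < t by rewrite lt_neqAle ct'.
pose h := Num.min (dR / 2) (t - c).
have h0 : 0 < h by rewrite lt_min; apply/andP; split; lra.
have hd : h < dR by rewrite gt_min; apply/orP; left; lra.
have hct : h <= t - c by rewrite ge_min lexx orbT.
have : X (c + h).
  split; first by apply/andP; split; lra.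
  move=> v /andP[sv vch]; have [vc|cv|->//] := ltgtP v c.
    by apply: below; rewrite sv.
  apply: le_trans sgc _; have -> : v = c + (v - c) by lra.
  by apply: hR; apply/andP; split; lra.
move=> /(ub_le_sup supX.2); rewrite -/c; lra.
Qed.

(** An injection into a countable type would make the interval a null set. *)
Lemma not_countable_interval a b (T : countType) (f : R -> T) : a < b ->
  (forall s t, a < s -> s < t -> t < b -> f s <> f t) -> False.
Proof.
move=> ab hf.
have cI : countable (`]a, b[%classic : set R).
  apply/countable_injP; exists (pickle \o f) => s t; rewrite !inE/= !in_itv/=.
  move=> /andP[s1 s2] /andP[t1 t2] /(pcan_inj pickleK) fst.
  by have [st|ts|//] := ltgtP s t; [case: (hf s t)|case: (hf t s)].
have := countable_lebesgue_measure0 cI.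
rewrite lebesgue_measure_itv/= lte_fin ab => /eqP.
by rewrite -EFinB eqe subr_eq0 gt_eqF.
Qed.

(** The dichotomy at 0+, translated to the point s. *)
Lemma right_germ g s : definable_fun g ->
  (exists2 d, 0 < d & forall h, 0 < h < d -> g s <= g (s + h)) \/
  (exists2 d, 0 < d & forall h, 0 < h < d -> g (s + h) < g s).
Proof.
move=> dg; have /definable_germ[] : definable (fun h => g s <= g (s + h)).
- by apply: definable_fun_le => //; polymap_tac.
- by move=> /near0P; left.
- move=> /near0P[d d0 hd]; right; exists d => // h /hd/negP.
  by rewrite -ltNge.
Qed.

Lemma left_germ g s : definable_fun g ->
  (exists2 d, 0 < d & forall h, 0 < h < d -> g (s - h) <= g s) \/
  (exists2 d, 0 < d & forall h, 0 < h < d -> g s < g (s - h)).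
Proof.
move=> dg; have /definable_germ[] : definable (fun h => g (s - h) <= g s).
- by apply: definable_fun_le => //; polymap_tac.
- by move=> /near0P; left.
- move=> /near0P[d d0 hd]; right; exists d => // h /hd/negP.
  by rewrite -ltNge.
Qed.

Lemma near0_and (P Q : R -> Prop) :
  (exists2 e, 0 < e & forall s, 0 < s < e -> P s) ->
  (exists2 e, 0 < e & forall s, 0 < s < e -> Q s) ->
  exists2 e, 0 < e & forall s, 0 < s < e -> P s /\ Q s.
Proof.
move=> /near0P hP /near0P hQ; apply/near0P; near=> s; split; near: s => //.
Unshelve. all: by end_near. Qed.

Lemma rat_near s d : 0 < d -> exists ab : rat * rat,
  s - d < ratr ab.1 < s /\ s < ratr ab.2 < s + d.
Proof.
move=> d0.
have [a] := @rat_in_itvoo R (s - d) s (ltac:(lra)); rewrite in_itv/= => ha.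
have [b] := @rat_in_itvoo R s (s + d) (ltac:(lra)); rewrite in_itv/= => hb.
by exists (a, b).
Qed.

(** [P s t] and [Q s t] compare the values at s and t for t to the right and to the
left of s.  If every s satisfies both conditions on a neighbourhood, pick
rational endpoints for it: two points that pick the same pair see each other,
against the incompatibility of [P] and [Q].  Such s are thus countably many.  A
strict local minimum is the typical example. *)
Lemma no_dense_extremum (P Q : R -> R -> Prop) e : 0 < e ->
  (forall s t, P s t -> Q t s -> False) ->
  (forall s, 0 < s < e ->
     (exists2 d, 0 < d & forall h, 0 < h < d -> P s (s + h)) /\
     (exists2 d, 0 < d & forall h, 0 < h < d -> Q s (s - h))) -> False.
Proof.
move=> e0 PQ hPQ.
have /choice[f hf] : forall s, exists ab : rat * rat, 0 < s < e ->
    ratr ab.1 < s < ratr ab.2 /\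
    (forall t, s < t < ratr ab.2 -> P s t) /\ (forall t, ratr ab.1 < t < s -> Q s t).
  move=> s; have [se|] := pselect (0 < s < e); last by exists (0, 0).
  have [[d1 d10 h1] [d2 d20 h2]] := hPQ s se.
  have d0 : 0 < Num.min d1 d2 by rewrite lt_min d10.
  have [ab [/andP[a1 a2] /andP[b1 b2]]] := rat_near s d0.
  have m1 : Num.min d1 d2 <= d1 by rewrite ge_min lexx.
  have m2 : Num.min d1 d2 <= d2 by rewrite ge_min lexx orbT.
  exists ab => _; split; first by rewrite a2.
  split=> t /andP[t1 t2].
    have -> : t = s + (t - s) by lra.
    by apply: h1; apply/andP; split; lra.
  have -> : t = s - (s - t) by lra.
  by apply: h2; apply/andP; split; lra.
apply: (@not_countable_interval 0 e _ f e0) => s t s0 st te fst.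
have [/andP[s1 s2] [hs _]] := hf s (ltac:(lra)).
have [/andP[t1 t2] [_ ht]] := hf t (ltac:(lra)).
apply: (PQ s t); first by apply: hs; rewrite st fst.
by apply: ht; rewrite -fst s1.
Qed.

(** The comparison of g s with the values just after s, and with those just before,
does not depend on s near 0.  Two of the four combinations propagate to
monotonicity; the two others make every s an extremum. *)
Theorem definable_monotone g : definable_fun g ->
  exists2 e, 0 < e &
    (forall s t, 0 < s -> s <= t -> t < e -> g s <= g t) \/
    (forall s t, 0 < s -> s < t -> t < e -> g t < g s).
Proof.
move=> dg.
pose Rge s := exists2 d, 0 < d & forall h, 0 < h < d -> g s <= g (s + h).
pose Rlt s := exists2 d, 0 < d & forall h, 0 < h < d -> g (s + h) < g s.
pose Lle s := exists2 d, 0 < d & forall h, 0 < h < d -> g (s - h) <= g s.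
pose Lgt s := exists2 d, 0 < d & forall h, 0 < h < d -> g s < g (s - h).
have dR : definable Rge.
  apply: (@definable_ext _ _ _ (fun s => exists d, 0 < d /\
      forall h, 0 < h -> h < d -> g s <= g (s + h))).
    move=> s; split=> [[d [d0 hd]]|[d d0 hd]]; exists d => //.
      by move=> h /andP[]; exact: hd.
    by split => // h h0 hh; apply: hd; rewrite h0.
  by definable_tac; apply: definable_fun_le => //; polymap_tac.
have dL : definable Lle.
  apply: (@definable_ext _ _ _ (fun s => exists d, 0 < d /\
      forall h, 0 < h -> h < d -> g (s - h) <= g s)).
    move=> s; split=> [[d [d0 hd]]|[d d0 hd]]; exists d => //.
      by move=> h /andP[]; exact: hd.
    by split => // h h0 hh; apply: hd; rewrite h0.
  by definable_tac; apply: definable_fun_le => //; polymap_tac.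
have hR : (exists2 e, 0 < e & forall s, 0 < s < e -> Rge s) \/
          (exists2 e, 0 < e & forall s, 0 < s < e -> Rlt s).
  have [/near0P|/near0P[e e0 he]] := definable_germ dR; first by left.
  right; exists e => // s /he ns.
  by have [|//] := right_germ s dg => /ns.
have hL : (exists2 e, 0 < e & forall s, 0 < s < e -> Lle s) \/
          (exists2 e, 0 < e & forall s, 0 < s < e -> Lgt s).
  have [/near0P|/near0P[e e0 he]] := definable_germ dL; first by left.
  right; exists e => // s /he ns.
  by have [|//] := left_germ s dg => /ns.
case: hR => hR; case: hL => hL; have [e e0 he] := near0_and hR hL; exists e => //.
- by left; exact: loc_nondecreasing.
- exfalso.
  apply: (@no_dense_extremum (fun s t => g s <= g t) (fun s t => g s < g t) e e0 _ he).
  by move=> s t st ts; move: (le_lt_trans st ts); rewrite ltxx.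
- exfalso.
  apply: (@no_dense_extremum (fun s t => g t < g s) (fun s t => g t <= g s) e e0 _ he).
  by move=> s t st ts; move: (le_lt_trans ts st); rewrite ltxx.
- right=> s t s0 st te.
  have mono : forall u v, 0 < u -> u <= v -> v < e -> - g u <= - g v.
    apply: loc_nondecreasing => u /he[[d1 d10 h1] [d2 d20 h2]].
    split; [exists d1|exists d2] => // h hd; rewrite lerN2 ltW//.
    - exact: h1.
    - exact: h2.
  have [[d d0 hd] _] := he s (ltac:(lra)).
  pose h := Num.min (d / 2) (t - s).
  have h0 : 0 < h by rewrite lt_min; apply/andP; split; lra.
  have hd' : h < d by rewrite gt_min; apply/orP; left; lra.
  have hts : h <= t - s by rewrite ge_min lexx orbT.
  apply: le_lt_trans (hd h _); last by rewrite h0.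
  rewrite -lerN2; apply: mono; lra.
Qed.

Definition continuous_pt g s := forall eta, 0 < eta ->
  exists2 d, 0 < d & forall t, s - d < t < s + d -> g s < g t + eta /\ g t < g s + eta.

Lemma definable_fun_ltD E (cE : coords R E) g (f1 f2 f3 : E -> R) :
  definable_fun g -> polymap f1 -> polymap f2 -> polymap f3 ->
  definable (fun e => g (f1 e) < g (f2 e) + f3 e).
Proof.
move=> dg p1 p2 p3.
apply: (definable_fun_subst (Q := fun e v => v < g (f2 e) + f3 e)) => //.
apply: (definable_fun_subst (Q := fun (e : E * R) v => e.2 < v + f3 e.1)) => //.
  by apply: (polymap_comp p2); polymap_tac.
apply: definable_lt; polymap_tac.
by apply: (polymap_comp p3); polymap_tac.
Qed.

Lemma definable_continuous_pt g : definable_fun g -> definable (continuous_pt g).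
Proof.
move=> dg; apply: (@definable_ext _ _ _ (fun s => forall eta, 0 < eta ->
  exists d, 0 < d /\ forall t, s - d < t -> t < s + d ->
    g s < g t + eta /\ g t < g s + eta)).
  move=> s; split=> hs eta /hs[d].
    by move=> [d0 hd]; exists d => // t /andP[]; exact: hd.
  by move=> d0 hd; exists d; split => // t t1 t2; apply: hd; rewrite t1.
by definable_tac; apply: definable_fun_ltD => //; polymap_tac.
Qed.

(** A monotone function with a jump at every point would choose a rational number
in each jump, injectively. *)
Lemma nondecreasing_continuity_pt g e : 0 < e ->
  (forall s t, 0 < s -> s <= t -> t < e -> g s <= g t) ->
  (forall s, 0 < s < e -> ~ continuous_pt g s) -> False.
Proof.
move=> e0 gm gd.
have /choice[q hq] : forall s, exists q : rat, 0 < s < e ->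
    (forall t, s < t < e -> ratr q < g t) /\ (forall t, 0 < t < s -> g t < ratr q).
  move=> s; have [se|] := pselect (0 < s < e); last by exists 0.
  have /andP[s0 se'] := se.
  have [eta eta0 jump] : exists2 eta, 0 < eta &
      (forall t, s < t < e -> g s + eta <= g t) \/
      (forall t, 0 < t < s -> g t <= g s - eta).
    apply: contrapT => nj; apply: (gd s se) => eta eta0.
    have : ~ ((forall t, s < t < e -> g s + eta <= g t) \/
        (forall t, 0 < t < s -> g t <= g s - eta)) by move=> h; apply: nj; exists eta.
    move=> /not_orP[/existsNP[t /not_implyP[/andP[t1 t2] /negP]]].
    rewrite -ltNge => gt1.
    move=> /existsNP[u /not_implyP[/andP[u1 u2] /negP]].
    rewrite -ltNge => gu1.
    exists (Num.min (t - s) (s - u)) => [|v].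
      by rewrite lt_min; apply/andP; split; lra.
    have m1 : Num.min (t - s) (s - u) <= t - s by rewrite ge_min lexx.
    have m2 : Num.min (t - s) (s - u) <= s - u by rewrite ge_min lexx orbT.
    move=> /andP[v1 v2].
    have := gm u v u1 ltac:(lra) ltac:(lra).
    have := gm v t ltac:(lra) ltac:(lra) t2.
    by lra.
  case: jump => jump.
    have [q] := @rat_in_itvoo R (g s) (g s + eta) (ltac:(lra)).
    rewrite in_itv/= => /andP[q1 q2]; exists q => _; split=> t tt.
      by apply: lt_le_trans q2 _; exact: jump.
    by apply: le_lt_trans q1; apply: gm; lra.
  have [q] := @rat_in_itvoo R (g s - eta) (g s) (ltac:(lra)).
  rewrite in_itv/= => /andP[q1 q2]; exists q => _; split=> t tt.
    by apply: lt_le_trans q2 _; apply: gm; lra.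
  by apply: le_lt_trans q1; exact: jump.
apply: (@not_countable_interval 0 e _ q e0) => s t s0 st te qst.
have [hs _] := hq s (ltac:(lra)); have [_ ht] := hq t (ltac:(lra)).
have := hs ((s + t) / 2) (ltac:(lra)).
have := ht ((s + t) / 2) (ltac:(lra)).
by rewrite qst => a b; have := lt_trans a b; rewrite ltxx.
Qed.

Theorem definable_tame g : definable_fun g ->
  exists2 e, 0 < e & (forall s, 0 < s < e -> continuous_pt g s) /\
    ((forall s t, 0 < s -> s <= t -> t < e -> g s <= g t) \/
     (forall s t, 0 < s -> s < t -> t < e -> g t < g s)).
Proof.
move=> dg; have [e1 e10 mono] := definable_monotone dg.
have [/near0P[e2 e20 hc]|/near0P[e2 e20 hc]] :=
  definable_germ (definable_continuous_pt dg).
all: have e0 : 0 < Num.min e1 e2 by rewrite lt_min e10.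
all: have m1 : Num.min e1 e2 <= e1 by rewrite ge_min lexx.
all: have m2 : Num.min e1 e2 <= e2 by rewrite ge_min lexx orbT.
  exists (Num.min e1 e2) => //; split.
    by move=> s /andP[s0 se]; apply: hc; apply/andP; split; lra.
  by case: mono => mono; [left|right] => s t s0 st te; apply: mono => //; lra.
exfalso; case: mono => mono.
  apply: (@nondecreasing_continuity_pt g _ e0).
    by move=> s t s0 st te; apply: mono => //; lra.
  by move=> s se; apply: hc; lra.
apply: (@nondecreasing_continuity_pt (fun s => - g s) _ e0).
  move=> s t s0; rewrite le_eqVlt => /predU1P[->|st] te; first by rewrite lexx.
  by rewrite lerN2 ltW//; apply: mono => //; lra.
move=> s se hs; apply: (hc s ltac:(lra)) => eta /hs[d d0 hd]; exists d => // t /hd.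
by lra.
Qed.

End Monotonicity.

(** * Definable selection *)

Section Selection.
Variable R : realType.
Context {T : topologicalType} {cT : coords R T}.
Hypothesis coords_continuous : forall i, continuous (fun u : T => (coords_of u)`_i : R).
Implicit Types (B : R -> set T) (s : R).

Lemma polymap_coord i : polymap (fun u : T => (coords_of u)`_i : R).
Proof. by apply/polymapP; exists (GRing.Var R i). Qed.

(** The points of [B s] that minimize the coordinates 0, ..., k - 1 in this order
of priority. *)
Fixpoint lexmin B k s : set T :=
  if k is j.+1 then
    [set u | lexmin B j s u /\
      forall v, lexmin B j s v -> (coords_of u)`_j <= (coords_of v)`_j]
  else B s.

Lemma definable_lexmin B k : definable (fun p : R * T => B p.1 p.2) ->
  definable (fun p : R * T => lexmin B k p.1 p.2).
Proof.
move=> dB; elim: k => //= k ih.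
definable_tac.
  refine (@definable_comp _ _ _ _ _ (fun p : R * T => lexmin B k p.1 p.2)
    (fun p : (R * T) * T => (p.1.1, p.2)) ih _).
  by polymap_tac.
apply: definable_le; apply: (polymap_comp (polymap_coord k)); polymap_tac.
Qed.

Lemma compact_lexmin B k s : compact (B s) -> B s !=set0 ->
  compact (lexmin B k s) /\ lexmin B k s !=set0.
Proof.
move=> cB B0; elim: k => //= k [cL L0].
have [u] := compact_EVT_min L0 cL
  (continuous_subspaceT (@coords_continuous k)).
rewrite inE => Lu umin; split; last first.
  by exists u; split=> // v Lv; apply: umin; rewrite inE.
rewrite [X in compact X](_ : _ = lexmin B k s `&`
    (fun v : T => (coords_of v)`_k : R) @^-1` [set x | x <= (coords_of u)`_k]).
  apply: compact_closedI => //; apply: preimage_closed.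
    by move=> x _; exact: coords_continuous.
  exact: closed_le.
apply/seteqP; split=> v /= [Lv vmin]; split=> //; first exact: vmin.
by move=> w Lw; apply: le_trans vmin _; apply: umin; rewrite inE.
Qed.

Lemma lexmin_le B j k s u : (j <= k)%N -> lexmin B k s u -> lexmin B j s u.
Proof.
move=> /subnK <-; elim: (k - j)%N => //= i ih [/ih//].
Qed.

Lemma lexmin_unique B s u v i : lexmin B (@ncoords _ _ cT) s u ->
  lexmin B (@ncoords _ _ cT) s v -> (coords_of u)`_i = (coords_of v)`_i.
Proof.
move=> Lu Lv; have [iN|iN] := ltnP i (@ncoords _ _ cT); last first.
  by rewrite !nth_default// size_coords.
have [Lu' ul] := lexmin_le iN Lu; have [Lv' vl] := lexmin_le iN Lv.
by apply/le_anti; rewrite ul// vl.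
Qed.

(** The lexicographically minimal points of a nonempty compact set exist and share
their coordinates, so that minimization is a choice, and it is first-order.
These coordinates are the values of the definable functions [g i]; the first one is moreover the least
first coordinate over [B s]. *)
Theorem definable_selection B : definable (fun p : R * T => B p.1 p.2) ->
  (forall s, compact (B s)) ->
  exists g : nat -> R -> R, (forall i, definable_fun (g i)) /\
    forall s, B s !=set0 -> exists2 u, B s u &
      (forall i, g i s = (coords_of u)`_i) /\
      (forall v, B s v -> g 0%N s <= (coords_of v)`_0).
Proof.
move=> dB cB; pose S := lexmin B (@ncoords _ _ cT).
have dS : definable (fun p : R * T => S p.1 p.2) by exact: definable_lexmin.
pose Gr (i : nat) s (a : R) := (exists2 u, S s u & a = (@coords_of _ _ cT u)`_i) \/
  ((forall u, ~ S s u) /\ a = 0).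
have /choice[g hg] : forall i, exists g : R -> R, forall s, Gr i s (g s).
  move=> i; have /choice[f hf] : forall s, exists a, Gr i s a; last by exists f.
  move=> s; have [[u Su]|nS] := pselect (exists u, S s u).
    by exists (coords_of u)`_i; left; exists u.
  by exists 0; right; split => // u Su; apply: nS; exists u.
exists g; split.
  move=> i; apply: (@definable_ext _ _ _ (fun p : R * R =>
     (exists u, S p.1 u /\ p.2 = (coords_of u)`_i) \/
     ((forall u, ~ S p.1 u) /\ p.2 = 0))).
    move=> [s a] /=; have [[u Su ->]|[nS ->]] := hg i s; split.
    - move=> [[v [Sv ->]]|[/(_ u)//]].
      exact: lexmin_unique Sv Su.
    - by move=> ->; left; exists u.
    - by move=> [[v [/nS]]|[_ ->]].
    - by move=> ->; right.
  definable_tac.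
  - refine (@definable_comp _ _ _ _ _ (fun p : R * T => S p.1 p.2)
      (fun p : (R * R) * T => (p.1.1, p.2)) dS _).
    by polymap_tac.
  - apply: definable_eq; first by polymap_tac.
    by apply: (polymap_comp (polymap_coord i)); polymap_tac.
  - refine (@definable_comp _ _ _ _ _ (fun p : R * T => S p.1 p.2)
      (fun p : (R * R) * T => (p.1.1, p.2)) dS _).
    by polymap_tac.
move=> s B0; have [_ [u Su]] := compact_lexmin (@ncoords _ _ cT) (cB s) B0.
have gE i : g i s = (coords_of u)`_i.
  have [[v Sv ->]|[/(_ u)//]] := hg i s.
  exact: lexmin_unique Sv Su.
exists u; first exact: (lexmin_le (leq0n _) Su).
split=> // v Bv; rewrite gE.
have [N0|N0] := posnP (@ncoords _ _ cT).
  by rewrite !nth_default// size_coords N0.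
by have [_] := lexmin_le N0 Su; apply.
Qed.

End Selection.

(** * Euclidean geometry of row vectors *)

Section Euclidean.
Variables (R : realType) (n : nat).
Implicit Types (u v w : 'rV[R]_n) (a : R).

Lemma dotC u v : dot u v = dot v u.
Proof. by apply: eq_bigr => i _; rewrite mulrC. Qed.

Lemma dotDl u v w : dot (u + v) w = dot u w + dot v w.
Proof. by rewrite -big_split; apply: eq_bigr => i _; rewrite mxE mulrDl. Qed.

Lemma dotZl a u v : dot (a *: u) v = a * dot u v.
Proof. by rewrite mulr_sumr; apply: eq_bigr => i _; rewrite mxE mulrA. Qed.

Lemma dotNl u v : dot (- u) v = - dot u v.
Proof. by rewrite -scaleN1r dotZl mulN1r. Qed.

Lemma dotDr u v w : dot u (v + w) = dot u v + dot u w.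
Proof. by rewrite dotC dotDl !(dotC u). Qed.

Lemma dotZr a u v : dot u (a *: v) = a * dot u v.
Proof. by rewrite dotC dotZl dotC. Qed.

Lemma dotNr u v : dot u (- v) = - dot u v.
Proof. by rewrite dotC dotNl dotC. Qed.

Definition dotE := (dotDl, dotDr, dotNl, dotNr, dotZl, dotZr).

Lemma dot_ge0 u : 0 <= dot u u.
Proof. by apply: sumr_ge0 => i _; rewrite -expr2 sqr_ge0. Qed.

Lemma dot_eq0 u : dot u u = 0 -> u = 0.
Proof.
move=> /eqP; rewrite psumr_eq0; last by move=> i _; rewrite -expr2 sqr_ge0.
move=> /allP h; apply/rowP => i; rewrite mxE.
by have := h i (mem_index_enum i); rewrite /= mulf_eq0 orbb => /eqP.
Qed.

Lemma enorm_ge0 u : 0 <= enorm u.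
Proof. exact: sqrtr_ge0. Qed.

Lemma sqr_enorm u : enorm u ^+ 2 = dot u u.
Proof. by rewrite sqr_sqrtr// dot_ge0. Qed.

Lemma dot_cauchy_schwarz u v : dot u v <= enorm u * enorm v.
Proof.
have [->|v0] := eqVneq v 0.
  by rewrite -[X in dot _ X](scale0r 0) dotZr mul0r mulr_ge0// enorm_ge0.
have vv0 : 0 < dot v v.
  by rewrite lt_neqAle dot_ge0 andbT eq_sym; apply: contraNN v0 => /eqP/dot_eq0/eqP.
apply: le_trans (ler_norm _) _.
rewrite -(@ler_pXn2r _ 2)// ?nnegrE ?mulr_ge0 ?enorm_ge0//.
rewrite real_normK ?num_real// exprMn !sqr_enorm.
have := dot_ge0 (dot v v *: u - dot u v *: v).
rewrite !dotE (dotC v u) => h.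
have {}h : 0 <= dot v v * (dot u u * dot v v - dot u v ^+ 2).
  by apply: le_trans h _; rewrite le_eqVlt; apply/orP; left; apply/eqP; ring.
by move: h; rewrite pmulr_rge0// subr_ge0.
Qed.

Lemma enormN u : enorm (- u) = enorm u.
Proof. by rewrite /enorm dotNl dotNr opprK. Qed.

Lemma ler_enormD u v : enorm (u + v) <= enorm u + enorm v.
Proof.
rewrite -(@ler_pXn2r _ 2)// ?nnegrE ?addr_ge0 ?enorm_ge0//.
rewrite sqrrD !sqr_enorm !dotE (dotC v u).
have := dot_cauchy_schwarz u v; lra.
Qed.

Lemma coord_le_enorm u i : `|u 0 i| <= enorm u.
Proof.
rewrite -(@ler_pXn2r _ 2)// ?nnegrE ?enorm_ge0// sqr_enorm.
rewrite real_normK ?num_real// /dot (bigD1 i)//= -expr2 lerDl.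
by apply: sumr_ge0 => j _; rewrite -expr2 sqr_ge0.
Qed.

Lemma norm_le_enorm u : `|u| <= enorm u.
Proof.
rewrite [leLHS]/Num.norm/= mx_normrE; apply/bigmax_leP; split; first exact: enorm_ge0.
by move=> [i j] _; rewrite ord1; exact: coord_le_enorm.
Qed.

Lemma enorm_le_sum u : enorm u <= \sum_i `|u 0 i|.
Proof.
have s0 : 0 <= \sum_i `|u 0 i| by exact: sumr_ge0.
rewrite -(@ler_pXn2r _ 2)// ?nnegrE ?enorm_ge0// sqr_enorm.
rewrite expr2 mulr_suml; apply: ler_sum => i _.
rewrite -expr2 -real_normK ?num_real// expr2 ler_wpM2l//.
by rewrite (bigD1 i)//= lerDl sumr_ge0.
Qed.

Lemma coord_le_norm u i : `|u 0 i| <= `|u|.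
Proof.
rewrite [leRHS]/Num.norm/= mx_normrE.
by apply: (@le_bigmax _ _ _ 0 (fun ij : 'I_1 * 'I_n => `|u ij.1 ij.2|) (0, i)).
Qed.

Section Continuity.
Context {T : topologicalType}.
Implicit Types f g : T -> 'rV[R]_n.

Lemma continuous_coord f i : continuous f -> continuous (fun x => f x 0 i : R).
Proof.
move=> cf x; apply: (@continuous_comp _ _ _ f (fun v : 'rV[R]_n => v 0 i)).
  exact: cf.
exact: coord_continuous.
Qed.

Lemma continuous_dot f g : continuous f -> continuous g ->
  continuous (fun x => dot (f x) (g x)).
Proof.
move=> cf cg x; apply: cvg_big => [|i _]; first exact: add_continuous.
by apply: cvgM; exact: continuous_coord.
Qed.

Lemma continuous_enorm f : continuous f -> continuous (fun x => enorm (f x)).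
Proof.
move=> cf x; apply: (@continuous_comp _ _ _ (fun x => dot (f x) (f x)) Num.sqrt).
  exact: continuous_dot.
exact: sqrt_continuous.
Qed.

End Continuity.

Section Polymap.
Context {E : Type} {cE : coords R E}.
Implicit Types f g : E -> 'rV[R]_n.

Lemma polymap_dot f g : polymap f -> polymap g ->
  polymap (fun e => dot (f e) (g e)).
Proof.
move=> /polymap_row pf /polymap_row pg.
by apply: polymap_sum => i; apply: polymapM.
Qed.

Lemma polymap_rowB f g : polymap f -> polymap g -> polymap (fun e => f e - g e).
Proof.
move=> /polymap_row pf /polymap_row pg; apply/polymap_row => i.
under eq_fun do rewrite !mxE.
by apply: polymapD => //; exact: polymapN.
Qed.

End Polymap.
End Euclidean.

(** * The Kurdyka-Lojasiewicz inequality *)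

Section Talweg.
Variables (R : realType) (K : nat).
Implicit Types (w : 'rV[R]_K) (A : set 'rV[R]_K) (F : 'rV[R]_K -> R) (rho s : R).

(** A substitute for a subgradient of norm at most rho: the lower bound is global
on A, with a fixed quadratic error.  It is first-order in (w, rho), and closed. *)
Definition slope_le A F (L : R) w rho := forall w', A w' ->
  F w <= F w' + rho * enorm (w' - w) + L * enorm (w' - w) ^+ 2.

(** The curve w, the talweg, takes on each level a point where the slope is at most
rho.  For fixed t and eta > 0, continuity of V makes the quadratic term smaller than
eta (V v - V u) for v close to u.  Then (rho t + eta) V - id is locally, hence
globally, nondecreasing on ]0, t[; let eta tend to 0. *)
Lemma talweg_le A F L Fs e (w : R -> 'rV[R]_K) (rho V : R -> R) : 0 <= L ->
  (forall s, 0 < s < e ->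
     [/\ A (w s), F (w s) = Fs + s & slope_le A F L (w s) (rho s)]) ->
  (forall s t, 0 < s -> s <= t -> t < e -> rho s <= rho t) ->
  (forall s, 0 < s < e -> 0 <= rho s) ->
  (forall s t, 0 < s -> s <= t -> t < e -> enorm (w s - w t) <= V t - V s) ->
  (forall s, 0 < s < e -> continuous_pt V s) ->
  forall s t, 0 < s -> s <= t -> t < e -> t - s <= rho t * (V t - V s).
Proof.
move=> L0 hw rhom rho0 hV cV s t s0 st te.
have Vm u v : 0 < u -> u <= v -> v < e -> V u <= V v.
  move=> u0 uv ve; rewrite -subr_ge0; apply: le_trans (hV u v u0 uv ve).
  exact: enorm_ge0.
have step eta u v : 0 < eta -> 0 < u -> u <= v -> v < t ->
    V v - V u <= eta / (L + 1) -> v - u <= (rho t + eta) * (V v - V u).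
  move=> eta0 u0 uv vt Vuv.
  have [_ Fv /(_ (w u))] := hw v ltac:(lra); have [Au Fu _] := hw u ltac:(lra).
  move=> /(_ Au); rewrite Fv Fu.
  set d := enorm _; set D := V v - V u in Vuv *.
  have dD : d <= D by apply: hV => //; lra.
  have d0 : 0 <= d by exact: enorm_ge0.
  have rv : rho v <= rho t by apply: rhom; lra.
  have rv0 : 0 <= rho v by apply: rho0; lra.
  have h1 : rho v * d <= rho t * D by apply: ler_pM.
  have h2 : L * d ^+ 2 <= eta * D.
    rewrite expr2 mulrA; apply: ler_pM => //; first by rewrite mulr_ge0.
    apply: (@le_trans _ _ (L * (eta / (L + 1)))).
      by apply: ler_wpM2l => //; lra.
    rewrite mulrCA -[leRHS]mulr1; apply: ler_wpM2l; first by lra.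
    by rewrite ler_pdivrMr; lra.
  by rewrite mulrDl; lra.
have loc eta u v : 0 < eta -> 0 < u -> u <= v -> v < t ->
    v - u <= (rho t + eta) * (V v - V u).
  move=> eta0 u0 uv vt.
  suff : (rho t + eta) * V u - u <= (rho t + eta) * V v - v by lra.
  have {}eta1 : 0 < eta / (L + 1) by rewrite divr_gt0//; lra.
  apply: (@loc_nondecreasing _ (fun x => (rho t + eta) * V x - x) 0 t) => //.
  move=> x /andP[x0 xt].
  have [d d0 hd] := cV x ltac:(lra) _ eta1.
  have m0 : 0 < Num.min d (Num.min x (t - x)).
    by rewrite !lt_min d0 x0; lra.
  have m1 : Num.min d (Num.min x (t - x)) <= d by rewrite ge_min lexx.
  have m2 : Num.min d (Num.min x (t - x)) <= x by rewrite !ge_min lexx orbT.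
  have m3 : Num.min d (Num.min x (t - x)) <= t - x by rewrite !ge_min lexx !orbT.
  split; exists (Num.min d (Num.min x (t - x))) => // h /andP[h0 hm].
    have [|a b] := hd (x + h); first by lra.
    have := step eta x (x + h) eta0 x0 ltac:(lra) ltac:(lra) ltac:(lra).
    lra.
  have [|a b] := hd (x - h); first by lra.
  have := step eta (x - h) x eta0 ltac:(lra) ltac:(lra) ltac:(lra) ltac:(lra).
  lra.
move: st; rewrite le_eqVlt => /predU1P[->|st]; first by rewrite !subrr mulr0.
have D0 : 0 <= V t - V s by rewrite subr_ge0; apply: Vm; lra.
apply/ler_addgt0Pr => eta eta0.
(* The local estimate holds strictly before t: it is used at t - eta', where
   eta' is so small that eta' (1 + V t - V s) <= eta. *)
pose eta' := Num.min (t - s) (eta / (1 + (V t - V s))).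
have e0 : 0 < eta' by rewrite lt_min divr_gt0//; lra.
have e1 : eta' <= t - s by rewrite ge_min lexx.
have e2 : eta' * (1 + (V t - V s)) <= eta.
  by rewrite -ler_pdivlMr; [rewrite ge_min lexx orbT | lra].
have := loc eta' s (t - eta') e0 s0 ltac:(lra) ltac:(lra).
have : (rho t + eta') * (V (t - eta') - V s) <= (rho t + eta') * (V t - V s).
  apply: ler_wpM2l; first by have := rho0 t ltac:(lra); lra.
  by have := Vm (t - eta') t ltac:(lra) ltac:(lra) ltac:(lra); lra.
by move: e2; rewrite mulrDr mulr1 mulrDl; lra.
Qed.

End Talweg.

Section Kurdyka.
Variables (R : realType) (K : nat).
Implicit Types (w : 'rV[R]_K) (A : set 'rV[R]_K) (F : 'rV[R]_K -> R) (rho s : R).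

Definition slope_graph A F (L Fs s : R) : set (R * 'rV[R]_K) :=
  [set u | [/\ A u.2, F u.2 = Fs + s, 0 <= u.1 <= 1 & slope_le A F L u.2 u.1]].

(** The Euclidean norm is not polynomial: it is described as the d >= 0 with
d^2 equal to the scalar square. *)
Lemma definable_slope_graph A F L Fs : definable A -> polymap F ->
  definable (fun p : R * (R * 'rV[R]_K) => slope_graph A F L Fs p.1 p.2).
Proof.
move=> dA pF.
apply: (@definable_ext _ _ _ (fun p : R * (R * 'rV[R]_K) =>
  A p.2.2 /\ (F p.2.2 = Fs + p.1 /\ ((0 <= p.2.1 /\ p.2.1 <= 1) /\
   forall w', A w' -> forall d, 0 <= d -> d ^+ 2 = dot (w' - p.2.2) (w' - p.2.2) ->
    F p.2.2 <= F w' + p.2.1 * d + L * d ^+ 2)))).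
  move=> [s [rho w]] /=; split.
    move=> [Aw [Fw [/andP rho01 sl]]]; split => //= w' Aw'.
    by apply: sl => //; [exact: enorm_ge0 | rewrite sqr_enorm].
  move=> [/= Aw Fw /andP rho01 sl]; do 3!split=> //.
  move=> w' Aw' d d0 dE; suff -> : d = enorm (w' - w) by exact: sl.
  by rewrite /enorm -dE sqrtr_sqr ger0_norm.
definable_tac.
- by apply: (@definable_comp _ _ _ _ _ A _ dA); polymap_tac.
- by apply: definable_eq; [apply: (polymap_comp pF)|]; polymap_tac.
- by apply: (@definable_comp _ _ _ _ _ A _ dA); polymap_tac.
- apply: definable_eq; first by polymap_tac.
  by apply: polymap_dot; apply: polymap_rowB; polymap_tac.
- apply: definable_le; first by apply: (polymap_comp pF); polymap_tac.
  by do 2?refine (polymapD _ _); [apply: (polymap_comp pF)|..]; polymap_tac.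
Qed.

Lemma closed_le_fun (T : topologicalType) (f g : T -> R) :
  continuous f -> continuous g -> closed [set x | f x <= g x].
Proof.
move=> cf cg; rewrite (_ : [set x | f x <= g x] =
  (fun x => f x - g x) @^-1` [set y | y <= 0]).
  apply: preimage_closed; last exact: closed_le.
  by move=> x _; apply: continuousB; [exact: cf | exact: cg].
by apply/seteqP; split=> x /=; rewrite subr_le0.
Qed.

Lemma compact_slope_graph A F L Fs s : compact A -> continuous F ->
  compact (slope_graph A F L Fs s).
Proof.
move=> cA cF.
have cF2 : continuous (fun u : R * 'rV[R]_K => F u.2).
  by move=> u; apply: (@continuous_comp _ _ _ snd F); [exact: cvg_snd | exact: cF].
rewrite (_ : slope_graph _ _ _ _ _ = (`[0, 1]%classic `*` A) `&`
  ([set u | F u.2 <= Fs + s] `&` [set u | Fs + s <= F u.2] `&`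
   \bigcap_(w' in A) [set u : R * 'rV[R]_K |
      F u.2 <= F w' + u.1 * enorm (w' - u.2) + L * enorm (w' - u.2) ^+ 2])).
  apply: compact_closedI; first by apply: compact_setX => //; exact: segment_compact.
  apply: closedI; first apply: closedI.
  - by apply: closed_le_fun => // u; exact: cvg_cst.
  - by apply: closed_le_fun => // u; exact: cvg_cst.
  apply: closed_bigI => w' _; apply: closed_le_fun => //.
  have cn : continuous (fun u : R * 'rV[R]_K => enorm (w' - u.2)).
    apply: continuous_enorm => u.
    by apply: continuousB; [exact: cvg_cst | exact: cvg_snd].
  move=> u; apply: cvgD; first apply: cvgD; first exact: cvg_cst.
    by apply: cvgM; [exact: cvg_fst | exact: cn].
  by apply: cvgM; [exact: cvg_cst|]; apply: cvgM; exact: cn.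
apply/seteqP; split=> u /=.
  move=> [Au Fu u01 sl]; split; first by split=> //=; rewrite in_itv.
  by rewrite Fu lexx.
rewrite in_itv/= => -[[u01 Au] [[F1 F2] sl]]; split=> //.
by apply/le_anti; rewrite F1 F2.
Qed.

Lemma continuous_coords_pair i :
  continuous (fun u : R * 'rV[R]_K => (coords_of u)`_i : R).
Proof.
case: i => [|i]; first by move=> u; exact: cvg_fst.
have [iK|iK] := ltnP i K; last first.
  rewrite (_ : (fun u : R * 'rV[R]_K => _) = (fun=> 0)).
    by move=> u; exact: cvg_cst.
  by apply/funext => u /=; rewrite nth_default// size_map size_enum_ord.
rewrite (_ : (fun u : R * 'rV[R]_K => _) = (fun u => u.2 0 (Ordinal iK))).
  by apply: continuous_coord => u; exact: cvg_snd.
apply/funext => u /=; rewrite (nth_map (Ordinal iK)) ?size_enum_ord//.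
by rewrite -[i]/(val (Ordinal iK)) nth_ord_enum.
Qed.

Lemma continuous_pt_sum (I : Type) (r : seq I) (f : I -> R -> R) s :
  (forall i, continuous_pt (f i) s) ->
  continuous_pt (fun t => \sum_(i <- r) f i t) s.
Proof.
move=> cf; elim: r => [|i r ih] eta eta0.
  by exists 1 => // t _; rewrite !big_nil; lra.
have [d1 d10 h1] := cf i _ (ltac:(lra) : 0 < eta / 2).
have [d2 d20 h2] := ih _ (ltac:(lra) : 0 < eta / 2).
have m1 : Num.min d1 d2 <= d1 by rewrite ge_min lexx.
have m2 : Num.min d1 d2 <= d2 by rewrite ge_min lexx orbT.
exists (Num.min d1 d2) => [|t /andP[ta tb]]; first by rewrite lt_min d10.
rewrite !big_cons; have := h1 t ltac:(lra); have := h2 t ltac:(lra).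
lra.
Qed.

Lemma continuous_ptN (f : R -> R) s : continuous_pt f s ->
  continuous_pt (fun t => - f t) s.
Proof. by move=> cf eta /cf[d d0 hd]; exists d => // t /hd; lra. Qed.

(** If the levels Fs + s are eventually without admissible pair there is nothing to
prove.  Otherwise select the least slope rho s and a point w s with this slope.
If rho is nondecreasing, [talweg_le] applies to the l1 arc length V of w, and
rho s is at most any other slope found on the level s. *)
Theorem kurdyka_inequality A F L Fs : 0 <= L -> definable A -> compact A ->
  polymap F -> continuous F ->
  exists2 e, 0 < e & exists V : R -> R,
    (forall s t, 0 <= s -> s <= t -> t < e -> V s <= V t) /\
    forall w rho s, A w -> 0 <= rho <= 1 -> slope_le A F L w rho ->
      0 <= s <= F w - Fs -> 0 < F w - Fs < e ->
      F w - Fs - s <= rho * (V (F w - Fs) - V s).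
Proof.
move=> L0 dA cA pF cF; pose B := slope_graph A F L Fs.
have dB : definable (fun p : R * (R * 'rV[R]_K) => B p.1 p.2).
  exact: definable_slope_graph.
have cB s : compact (B s) by exact: compact_slope_graph.
have BI w rho : A w -> 0 <= rho <= 1 -> slope_le A F L w rho -> B (F w - Fs) (rho, w).
  by move=> Aw r01 sl; split=> //=; lra.
have : definable (fun s => exists u, B s u) by definable_tac.
move=> /definable_germ[/near0P[e0 e00 Bne]|/near0P[e e0 Be]]; last first.
  exists e => //; exists (fun=> 0); split=> // w rho s Aw r01 sl _ Fwe.
  by exfalso; apply: (Be _ Fwe); exists (rho, w); exact: BI.
have [g [dg gP]] := definable_selection continuous_coords_pair dB cB.
have /choice[ee hee] : forall i, exists e, 0 < e /\
    (forall s, 0 < s < e -> continuous_pt (g i) s) /\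
    ((forall s t, 0 < s -> s <= t -> t < e -> g i s <= g i t) \/
     (forall s t, 0 < s -> s < t -> t < e -> g i t < g i s)).
  by move=> i; have [e e1 h] := definable_tame (dg i); exists e.
pose e := \big[Num.min/e0]_(i < K.+1) ee i.
have egt0 : 0 < e by apply: lt_bigmin => // i _; have [] := hee i.
have ele0 : e <= e0 by exact: bigmin_le_id.
have ele i : (i < K.+1)%N -> e <= ee i.
  by move=> iK; exact: (bigmin_le e0 (Ordinal iK)).
have gc i s : (i < K.+1)%N -> 0 < s < e -> continuous_pt (g i) s.
  move=> iK /andP[s0 se]; have [_ [h _]] := hee i; apply: h.
  by have := ele i iK; lra.
have gm i : (i < K.+1)%N ->
    (forall s t, 0 < s -> s <= t -> t < e -> g i s <= g i t) \/
    (forall s t, 0 < s -> s < t -> t < e -> g i t < g i s).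
  move=> iK; have := ele i iK; have [_ [_ [h|h]]] := hee i => eei.
    by left=> s t s0 st te; apply: h => //; lra.
  by right=> s t s0 st te; apply: h => //; lra.
pose w s : 'rV[R]_K := \row_i g i.+1 s.
have wP s : 0 < s < e -> [/\ B s (g 0%N s, w s) &
    forall v, B s v -> g 0%N s <= v.1].
  move=> /andP[s0 se]; have [|[r v] Bv [gE gmin]] := gP s.
    by apply: Bne; lra.
  split; last by move=> u /gmin.
  suff -> : (g 0%N s, w s) = (r, v) by [].
  congr (_, _); first by rewrite gE.
  apply/rowP => i; rewrite mxE gE /= (nth_map i) ?size_enum_ord//.
  by rewrite nth_ord_enum.
have g0ge0 s : 0 < s < e -> 0 <= g 0%N s.
  by move=> /wP[[_ _ /= /andP[]]].
(* A least slope that decreases with the level is bounded below by some r0 > 0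
   near 0, and V t = t / r0 is enough. *)
have [mono|anti] := gm 0%N isT; last first.
  pose r0 := g 0%N (e / 2).
  have r0gt0 : 0 < r0.
    apply: (@le_lt_trans _ _ (g 0%N (3 * e / 4))); first by apply: g0ge0; lra.
    by apply: anti; lra.
  exists (e / 2); first by lra.
  exists (fun t => t / r0); split.
    by move=> s t _ st _; rewrite ler_pM2r// invr_gt0.
  move=> v rho s Av r01 sl /andP[s0 sF] /andP[F0 Fe].
  have [_ /(_ _ (BI v rho Av r01 sl)) /= rhog] := wP (F v - Fs) ltac:(lra).
  have r0rho : r0 <= rho.
    by apply: le_trans rhog; apply: ltW; apply: anti; lra.
  rewrite -mulrBl mulrCA -[leLHS]mulr1; apply: ler_wpM2l; first by lra.
  by rewrite ler_pdivlMr// mul1r.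
(* The signs that make the coordinates of the curve nondecreasing: V is its arc
   length in the l1 norm. *)
have /choice[sg hsg] : forall i : 'I_K, exists sg : R, (sg = 1 \/ sg = -1) /\
    forall s t, 0 < s -> s <= t -> t < e ->
      `|g i.+1 s - g i.+1 t| = sg * g i.+1 t - sg * g i.+1 s.
  move=> i; have [h|h] := gm i.+1 (ltn_ord i).
    exists 1; split; first by left.
    move=> s t s0 st te; rewrite ler0_norm ?subr_le0; [|exact: h].
    by rewrite opprB !mul1r.
  exists (-1); split; first by right.
  move=> s t s0; rewrite le_eqVlt => /predU1P[<-|st] te.
    by rewrite !subrr normr0.
  by rewrite gtr0_norm ?subr_gt0; [rewrite !mulN1r opprK addrC|exact: h].
pose V s := \sum_(i < K) sg i * g i.+1 s.
have wV s t : 0 < s -> s <= t -> t < e -> enorm (w s - w t) <= V t - V s.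
  move=> s0 st te; apply: le_trans (enorm_le_sum _) _.
  rewrite /V -sumrB; apply: ler_sum => i _.
  by rewrite !mxE (hsg i).2.
have cV s : 0 < s < e -> continuous_pt V s.
  move=> se; apply: continuous_pt_sum => i.
  have cgi : continuous_pt (g i.+1) s by apply: gc => //; exact: (ltn_ord i).
  have [[->|->] _] := hsg i.
    by under eq_fun do rewrite mul1r.
  by under eq_fun do rewrite mulN1r; exact: continuous_ptN.
have Vm s t : 0 < s -> s <= t -> t < e -> V s <= V t.
  move=> s0 st te; rewrite -subr_ge0; apply: le_trans (wV s t s0 st te).
  exact: enorm_ge0.
have [M hM] : exists M, forall v, A v -> `|v| <= M.
  have [M [_ hM]] := compact_bounded cA; exists (M + 1) => v Av.
  by apply: (hM (M + 1)) => //; rewrite ltrDl.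
have [C hC] : exists C, forall s, 0 < s < e -> C <= V s.
  exists (- \sum_(i < K) M) => s se; rewrite /V -sumrN; apply: ler_sum => i _.
  have [[Aw _ _ _] _] := wP s se.
  have := le_trans (coord_le_norm (w s) i) (hM _ Aw); rewrite mxE ler_norml.
  by have [[->|->] _] := hsg i; lra.
(* At level 0 the curve may have no point; the bound C stands for the limit of V. *)
exists e => //; exists (fun s => if 0 < s then V s else C); split.
  move=> s t s0 st te; case: ifPn => [sgt0|sle0].
    by rewrite (lt_le_trans sgt0 st); exact: Vm.
  by case: ifPn => // t0; apply: hC; rewrite t0.
move=> v rho s Av r01 sl /andP[s0 sF] /andP[F0 Fe].
have [_ /(_ _ (BI v rho Av r01 sl)) /= rhog] := wP (F v - Fs) ltac:(lra).
set f := F v - Fs in sF F0 Fe rhog *; rewrite F0.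
have kl u : 0 < u -> u <= f -> f - u <= rho * (V f - V u).
  move=> u0 uf; apply: le_trans (_ : g 0%N f * (V f - V u) <= _); last first.
    by apply: ler_wpM2r => //; rewrite subr_ge0; exact: Vm.
  apply: (@talweg_le R K A F L Fs e w (g 0%N) V L0) => //.
  by move=> x /wP[[]].
case: ifPn => [sgt0|]; first exact: kl.
rewrite -leNgt => sle0; have {s0 sle0 sF}-> : s = 0 by lra.
rewrite subr0; apply/ler_addgt0Pr => eta eta0.
pose u := Num.min eta f.
have u0 : 0 < u by rewrite lt_min eta0.
have ueta : u <= eta by rewrite ge_min lexx.
have uf : u <= f by rewrite ge_min lexx orbT.
have := kl u u0 uf.
have : rho * (V f - V u) <= rho * (V f - C).
  apply: ler_wpM2l; first by lra.
  by have := hC u ltac:(lra); lra.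
lra.
Qed.

End Kurdyka.

(** * Semialgebraic sets, projections and proximal normals *)

Section SemialgebraicDefinable.
Variables (R : realType) (n : nat).

Lemma polymap_meval (p : mpoly.mpoly n R) :
  polymap (fun x : 'rV[R]_n => mpoly.meval (fun i => x 0 i) p).
Proof.
under eq_fun do rewrite mpoly.mevalE.
apply: polymap_sum => m; apply: polymapM; first exact: polymap_cst.
apply: polymap_prod => i; apply: polymapX.
by have /polymap_row := @polymap_id R _ (@coords_row R n).
Qed.

(** The definition is already a quantifier-free formula. *)
Lemma semialgebraic_definable (S : set 'rV[R]_n) : semialgebraic S -> definable S.
Proof.
move=> [F ->]; elim: F => [|[hs gs] F ih] /=; first exact: definable_cst.
apply: (@definable_ext _ _ _ (fun x : 'rV[R]_n =>
  (all (fun h => mpoly.meval (fun i => x 0 i) h == 0) hs /\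
   all (fun g => mpoly.meval (fun i => x 0 i) g < 0) gs) \/
  has (fun hg => all (fun h => mpoly.meval (fun i => x 0 i) h == 0) hg.1 &&
     all (fun g => mpoly.meval (fun i => x 0 i) g < 0) hg.2) F)).
  move=> x; split.
    by move=> [[h g]|f]; apply/orP; [left; apply/andP|right].
  by move=> /orP[/andP[? ?]|?]; [left|right].
apply: definable_or => //; apply: definable_and.
  elim: hs => [|h hs ihs] /=; first exact: definable_cst.
  apply: (@definable_ext _ _ _ (fun x : 'rV[R]_n =>
    mpoly.meval (fun i => x 0 i) h = 0 /\
    all (fun h => mpoly.meval (fun i => x 0 i) h == 0) hs)).
    by move=> x; split=> [[/eqP hx hs0]|/andP[/eqP]//]; apply/andP.
  apply: definable_and => //; apply: definable_eq; last exact: polymap_cst.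
  exact: polymap_meval.
elim: gs => [|g gs ihs] /=; first exact: definable_cst.
apply: (@definable_ext _ _ _ (fun x : 'rV[R]_n =>
  mpoly.meval (fun i => x 0 i) g < 0 /\
  all (fun g => mpoly.meval (fun i => x 0 i) g < 0) gs)).
  by move=> x; split=> [/andP//|/andP].
apply: definable_and => //; apply: definable_lt; last exact: polymap_cst.
exact: polymap_meval.
Qed.

End SemialgebraicDefinable.

Section Projection.
Variables (R : realType) (n : nat).
Implicit Types (C D : set 'rV[R]_n) (u v p c x z : 'rV[R]_n).

Lemma proj_nearest C u : C !=set0 -> closed C ->
  C (proj C u) /\ forall c, C c -> enorm (u - proj C u) <= enorm (u - c).
Proof.
move=> [c0 Cc0] clC.
have cnt : continuous (fun p : 'rV[R]_n => enorm (u - p)).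
  apply: continuous_enorm => p.
  by apply: (@continuousB _ _ _ (fun=> u) id p); [exact: cst_continuous | by []].
pose K := C `&` [set p | enorm (u - p) <= enorm (u - c0)].
have cK : compact K.
  apply: bounded_closed_compact; last first.
    by apply: closedI => //; apply: closed_le_fun => //; exact: cst_continuous.
  exists (`|u| + enorm (u - c0)); split; first exact: num_real.
  move=> M hM p [_ /= hp]; apply: le_trans (ltW hM).
  have -> : p = u - (u - p) by rewrite opprB addrC subrK.
  apply: le_trans (ler_normB _ _) _; rewrite lerD2l.
  exact: le_trans (norm_le_enorm _) hp.
have [|p] := compact_EVT_min _ cK (continuous_subspaceT cnt).
  by exists c0; split => //=.
rewrite inE => -[Cp /= pc0] pmin.
have pC c : C c -> enorm (u - p) <= enorm (u - c).
  move=> Cc; have [cc0|cc0] := leP (enorm (u - c)) (enorm (u - c0)).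
    by apply: pmin; rewrite inE.
  by apply: le_trans pc0 (ltW cc0).
have dE : enorm (u - p) = dist C u.
  apply/le_anti/andP; split.
    apply: lb_le_inf; first by exists (enorm (u - c0)), c0.
    by move=> _ [c Cc <-]; exact: pC.
  apply: ge_inf; last by exists p.
  by exists 0 => _ [c _ <-]; exact: enorm_ge0.
have : [set q | C q /\ enorm (u - q) = dist C u] (proj C u).
  by apply: (xgetPex 0); exists p.
by move=> [Cq qE]; split=> // c; rewrite qE -dE; exact: pC.
Qed.

(** Compare p with the points p + l (c - p) of C and let l tend to 0. *)
Lemma proj_variational C u c : C !=set0 -> closed C -> convex_set C -> C c ->
  dot (u - proj C u) (c - proj C u) <= 0.
Proof.
move=> C0 clC cvxC Cc; have [Cp pmin] := proj_nearest u C0 clC.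
set p := proj C u in Cp pmin *.
have key l : 0 < l -> l <= 1 ->
    2 * dot (u - p) (c - p) <= l * dot (c - p) (c - p).
  move=> l0 l1.
  have : C (p + l *: (c - p)).
    have := cvxC c p (Itv01 (ltW l0) l1); rewrite !inE => /(_ Cc Cp).
    congr (C _); rewrite /conv/=.
    by apply/rowP => i; rewrite !mxE /unstable.onem; ring.
  move=> /pmin; rewrite -(@ler_pXn2r _ 2)// ?nnegrE ?enorm_ge0// !sqr_enorm.
  rewrite opprD addrA !(dotDl (u - p)) !(dotDr _ (u - p)).
  rewrite !dotNr !dotNl opprK !dotZl !dotZr (dotC (c - p) (u - p)) => h.
  rewrite -(ler_pM2l l0); lra.
apply/ler_addgt0Pr => eta eta0; rewrite add0r.
pose d := dot (c - p) (c - p).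
have d0 : 0 <= d by exact: dot_ge0.
pose l := Num.min 1 (eta / (1 + d)).
have l0 : 0 < l by rewrite lt_min ltr01 divr_gt0//; lra.
have l1 : l <= 1 by rewrite ge_min lexx.
have l2 : l * (1 + d) <= eta.
  by rewrite -ler_pdivlMr; [rewrite ge_min lexx orbT | lra].
have := key l l0 l1; rewrite -/d; move: l2; rewrite mulrDr mulr1; lra.
Qed.

(** Add up the variational inequalities at the two candidates. *)
Lemma variational_proj C u p : C !=set0 -> closed C -> convex_set C -> C p ->
  (forall c, C c -> dot (u - p) (c - p) <= 0) -> proj C u = p.
Proof.
move=> C0 clC cvxC Cp hp; have [Cq _] := proj_nearest u C0 clC.
have h1 := @proj_variational C u p C0 clC cvxC Cp; have h2 := hp _ Cq.
set q := proj C u in Cq h1 h2 *.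
apply/eqP; rewrite -subr_eq0; apply/eqP/dot_eq0/le_anti; rewrite dot_ge0 andbT.
by move: h1 h2; rewrite !dotE !(dotC p q); lra.
Qed.

(** Off D the quotient is nonnegative, and on D it is at least - mu |w - z|, which
tends to 0. *)
Lemma proximal_frechet D z v (mu : R) : 0 <= mu -> D z ->
  (forall w, D w -> dot v (w - z) <= mu * enorm (w - z) ^+ 2) ->
  frechet_subdiff (indicator D) z v.
Proof.
move=> mu0 Dz hv; have iz : indicator D z = 0%E by rewrite /indicator asboolT.
split; first by rewrite iz.
rewrite limf_einfE iz; set S := ereal_sup _.
have key e : 0 < e -> ((- e)%:E <= S)%E.
  move=> e0; have e1 : 0 < e / (mu + 1) by rewrite divr_gt0//; lra.
  have Vz : nbhs z [set w | enorm (w - z) < e / (mu + 1)].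
    have ce : continuous (fun w : 'rV[R]_n => enorm (w - z)).
      apply: continuous_enorm => w.
      by apply: (@continuousB _ _ _ id (fun=> z) w); [by []|exact: cst_continuous].
    have /cvgr_lt := ce z; apply; rewrite subrr /enorm.
    by rewrite -[X in dot X _](scale0r 0) dotZl mul0r sqrtr0.
  apply: (@le_trans _ _ (ereal_inf [set ((indicator D w - 0 - (dot v (w - z))%:E) *
    ((enorm (w - z))^-1)%:E)%E | w in [set w | enorm (w - z) < e / (mu + 1)]])).
    apply/ereal_infP => _ [w /= we <-].
    have N0 := enorm_ge0 (w - z); set N := enorm _ in we N0 *.
    have [Dw|nDw] := pselect (D w); last first.
      rewrite /indicator asboolF// sube0.
      apply: (@le_trans _ _ 0%E); first by rewrite lee_fin; lra.
      by apply: mule_ge0; [rewrite addye | rewrite lee_fin invr_ge0].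
    rewrite /indicator asboolT// sube0 add0e -EFinM lee_fin.
    have h : dot v (w - z) * N^-1 <= mu * N.
      have [N00|N00] := eqVneq N 0; first by rewrite N00 invr0 !mulr0.
      rewrite ler_pdivrMr ?lt0r ?N00//; apply: le_trans (hv w Dw) _.
      by rewrite -/N expr2 mulrA.
    have h2 : mu * N <= e.
      apply: (@le_trans _ _ (mu * (e / (mu + 1)))).
        by apply: ler_wpM2l => //; exact: ltW.
      rewrite mulrCA -[leRHS]mulr1; apply: ler_wpM2l; first by lra.
      by rewrite ler_pdivrMr; lra.
    by rewrite mulNr; lra.
  apply: ereal_sup_ubound => /=; exists [set w | enorm (w - z) < e / (mu + 1)] => //.
  exact: nbhs_dnbhs.
apply/lee_addgt0Pr => e e0.
rewrite -(_ : (- e)%:E + e%:E = 0)%E; first exact: leeD2r (key e e0).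
by rewrite -EFinD addNr.
Qed.

End Projection.

(** * The merit function *)

Section Algebra.
Variables (R : realType) (n : nat) (g : R).
Hypotheses (g0 : 0 < g) (g1 : g < 1).
Implicit Types (p z y u v : 'rV[R]_n).

Definition merit p z y := g * dot (z - p) (z - p) + (1 - g) * dot (z - y) (z - y).

(** With q = y - p, q' = y' - p', and dy = y' - y, the relation between z and y'
and the optimality of z' give, after expansion, a drop of at least
|dy|^2 - 2 gamma^2 |q' - q|^2, plus a term that is nonnegative by the first
variational inequality.  The two variational inequalities together say that
y - p is a nonexpansive function of y, whence |q' - q| <= |dy|; it also follows
that |z - y| <= (1 + gamma) |dy|. *)
Lemma merit_decrease p z y p' z' y' :
  z = y' + g *: ((y' - p') - (y - p)) ->
  enorm (y' - g *: (y' - p') - z') ^+ 2 <= enorm (y' - g *: (y' - p') - z) ^+ 2 ->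
  dot (y' - p') (p - p') <= 0 -> dot (y - p) (p' - p) <= 0 -> 2 * g ^+ 2 <= 1 ->
  (1 - 2 * g ^+ 2) * dot (z - y) (z - y) <=
    (1 + g) ^+ 2 * (merit p z y - merit p' z' y').
Proof.
move=> zE; rewrite !sqr_enorm /merit.
set q := y - p; set q' := y' - p'; set d := y' - y; set e := z' - y'.
have -> : y' - g *: q' - z' = - (e + g *: q').
  by apply/rowP => i; rewrite !mxE; ring.
have -> : y' - g *: q' - z = - (g *: (2 *: q' - q)).
  by rewrite zE; apply/rowP => i; rewrite !mxE; ring.
have -> : p - p' = q' - q - d by apply/rowP => i; rewrite !mxE; ring.
have -> : p' - p = d + q - q' by apply/rowP => i; rewrite !mxE; ring.
have -> : z - y = d + g *: (q' - q) by rewrite zE; apply/rowP => i; rewrite !mxE; ring.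
have -> : z - p = d + g *: (q' - q) + q.
  by rewrite zE; apply/rowP => i; rewrite !mxE; ring.
have -> : z' - p' = e + q' by apply/rowP => i; rewrite !mxE; ring.
move: q q' d e => q q' d e {zE} hopt v1 v2 g2.
have nonexp : dot (q' - q) (q' - q) <= dot d d.
  have := dot_ge0 (d - (q' - q)); move: v1 v2.
  rewrite !dotE !(dotC d q) !(dotC d q') !(dotC q' q); lra.
have a1 : dot (d + g *: (q' - q)) (d + g *: (q' - q)) <= (1 + g) ^+ 2 * dot d d.
  have c : dot d (q' - q) <= dot d d.
    have := dot_ge0 (d - (q' - q)); move: nonexp.
    rewrite !dotE !(dotC d q) !(dotC d q') !(dotC q' q); lra.
  have c1 := ler_wpM2l (ltW g0) c.
  have c2 := ler_wpM2l (sqr_ge0 g) nonexp.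
  move: c1 c2; rewrite !dotE !(dotC d q) !(dotC d q') !(dotC q' q); lra.
have a2 : (1 - 2 * g ^+ 2) * dot d d <=
   g * dot (d + g *: (q' - q) + q) (d + g *: (q' - q) + q) +
   (1 - g) * dot (d + g *: (q' - q)) (d + g *: (q' - q)) -
   (g * dot (e + q') (e + q') + (1 - g) * dot e e).
  have c1 := ler_wpM2l (ltW g0) v1; have c2 := ler_wpM2l (ltW g0) v2.
  have c3 := ler_wpM2l (sqr_ge0 g) nonexp.
  have c4 := ler_wpM2l (ltW g0) (dot_ge0 (q' - q)).
  move: hopt c1 c2 c3 c4.
  rewrite !dotE !(dotC d q) !(dotC d q') !(dotC q' q) !(dotC e q').
  lra.
apply: le_trans (_ : (1 - 2 * g ^+ 2) * ((1 + g) ^+ 2 * dot d d) <= _).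
  by apply: ler_wpM2l => //; lra.
by rewrite mulrCA; apply: ler_wpM2l => //; exact: sqr_ge0.
Qed.

(** The first order terms in y - p along p' - p and z' - z are controlled by the
variational inequality at p and by the optimality of z.  Their coefficients are
such that the part along z' - z cancels, which leaves multiples of z - y. *)
Lemma merit_slope p z y p' z' y' :
  dot (y - p) (p' - p) <= 0 ->
  enorm (y - g *: (y - p) - z) ^+ 2 <= enorm (y - g *: (y - p) - z') ^+ 2 ->
  merit p z y <= merit p' z' y'
    + 2 * enorm (z - y) * (g * enorm (p' - p) + (1 - g) * enorm (y' - y))
    + dot (z' - z) (z' - z).
Proof.
rewrite !sqr_enorm /merit.
set q := y - p; set e := z - y; set a := p' - p; set b := z' - z; set c := y' - y.
have -> : y - g *: q - z = - (e + g *: q) by apply/rowP => i; rewrite !mxE; ring.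
have -> : y - g *: q - z' = - (e + g *: q + b) by apply/rowP => i; rewrite !mxE; ring.
have -> : z - p = e + q by apply/rowP => i; rewrite !mxE; ring.
have -> : z' - p' = e + q + b - a by apply/rowP => i; rewrite !mxE; ring.
have -> : z' - y' = e + b - c by apply/rowP => i; rewrite !mxE; ring.
move: q e a b c => q e a b c v1 opt.
have g1' : 0 <= 1 - g by rewrite subr_ge0 ltW.
have c1 := ler_wpM2l (ltW g0) v1.
have c2 := ler_wpM2l (ltW g0) (dot_cauchy_schwarz e a).
have c3 := ler_wpM2l g1' (dot_cauchy_schwarz e c).
have c4 := mulr_ge0 (ltW g0) (dot_ge0 (b - a)).
have c5 := mulr_ge0 g1' (dot_ge0 (b - c)).
move: opt c1 c2 c3 c4 c5; rewrite !dotE.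
rewrite !(dotC b e) !(dotC a e) !(dotC c e) !(dotC b q) !(dotC a q).
rewrite !(dotC q e) !(dotC b a) !(dotC c b); lra.
Qed.

Lemma merit_ge p z y : g * enorm (z - p) ^+ 2 <= merit p z y /\
  (1 - g) * enorm (z - y) ^+ 2 <= merit p z y.
Proof.
rewrite /merit !sqr_enorm.
have c1 := mulr_ge0 (ltW g0) (dot_ge0 (z - p)).
have c2 : 0 <= (1 - g) * dot (z - y) (z - y) by rewrite mulr_ge0 ?dot_ge0// subr_ge0 ltW.
by split; lra.
Qed.

End Algebra.

Section Triples.
Variables (R : realType) (n : nat).
Implicit Types (w h : 'rV[R]_(n + (n + n))) (p z y : 'rV[R]_n).

(** One row vector for the three blocks, as the inequality of the previous part is
about a function on row vectors. *)
Definition triple p z y : 'rV[R]_(n + (n + n)) := row_mx p (row_mx z y).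
Definition triple1 w : 'rV[R]_n := lsubmx w.
Definition triple2 w : 'rV[R]_n := lsubmx (rsubmx w).
Definition triple3 w : 'rV[R]_n := rsubmx (rsubmx w).

Lemma tripleK p z y : [/\ triple1 (triple p z y) = p, triple2 (triple p z y) = z &
  triple3 (triple p z y) = y].
Proof. by rewrite /triple1 /triple2 /triple3 /triple !row_mxKr !row_mxKl. Qed.

Lemma dot_triple w : dot w w =
  dot (triple1 w) (triple1 w) + dot (triple2 w) (triple2 w) + dot (triple3 w) (triple3 w).
Proof.
rewrite /dot big_split_ord big_split_ord /= addrA.
by congr (_ + _ + _); apply: eq_bigr => i _; rewrite !mxE.
Qed.

Lemma enorm_parts w : [/\ enorm (triple1 w) <= enorm w, enorm (triple2 w) <= enorm w &
  enorm (triple3 w) <= enorm w].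
Proof.
have h a b : 0 <= b -> Num.sqrt a <= Num.sqrt (a + b :> R).
  by move=> b0; rewrite ler_wsqrtr// lerDl.
have c := dot_ge0 (triple1 w); have d := dot_ge0 (triple2 w).
have e := dot_ge0 (triple3 w).
split; rewrite /enorm (dot_triple w).
- by rewrite -addrA h// addr_ge0.
- by rewrite (addrC (dot (triple1 w) _)) -addrA h// addr_ge0.
- by rewrite addrC h// addr_ge0.
Qed.

Lemma polymap_entry k (j : 'I_k) : polymap (fun v : 'rV[R]_k => v 0 j).
Proof. by have /polymap_row := @polymap_id R _ (@coords_row R k); apply. Qed.

Lemma polymap_triple1 : polymap triple1.
Proof.
apply/polymap_row => i; under eq_fun do rewrite mxE.
exact: polymap_entry.
Qed.

Lemma polymap_triple2 : polymap triple2.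
Proof.
apply/polymap_row => i; under eq_fun do rewrite !mxE.
exact: polymap_entry.
Qed.

Lemma polymap_triple3 : polymap triple3.
Proof.
apply/polymap_row => i; under eq_fun do rewrite !mxE.
exact: polymap_entry.
Qed.

Lemma continuous_triple1 : continuous triple1.
Proof. exact: continuous_lsubmx. Qed.

Lemma continuous_triple2 : continuous triple2.
Proof.
move=> w; apply: (@continuous_comp _ _ _ rsubmx lsubmx).
  exact: continuous_rsubmx.
exact: continuous_lsubmx.
Qed.

Lemma continuous_triple3 : continuous triple3.
Proof.
move=> w; apply: (@continuous_comp _ _ _ rsubmx rsubmx); exact: continuous_rsubmx.
Qed.

End Triples.

Section FiniteLength.
Variables (R : realType) (n : nat).

Lemma cvg_of_finite_length (u : nat -> 'rV[R]_n) (d : nat -> R) (B : R) :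
  (forall t, enorm (u t.+1 - u t) <= d t) ->
  (forall N, \sum_(0 <= t < N) d t <= B) -> cvgn u.
Proof.
move=> ud dB.
have : cvgn (series (fun t => u t.+1 - u t)).
  have : cvgn [normed series (fun t => u t.+1 - u t)].
    have sE N : [normed series (fun t => u t.+1 - u t)] N =
      \sum_(0 <= t < N) `|u t.+1 - u t| by [].
    apply: nondecreasing_is_cvgn.
      by apply/nondecreasing_seqP => N; rewrite !sE big_nat_recr//= lerDl.
    exists B => _ [N _ <-]; apply: le_trans (dB N); rewrite sE.
    by apply: ler_sum => t _; exact: le_trans (norm_le_enorm _) (ud t).
  (* Absolute summability passes to the series through the Cauchy criterion. *)
  move=> /cauchy_cvgP/cauchy_seriesP u_ncvg.
  apply/cauchy_cvgP/cauchy_seriesP => e /u_ncvg; apply: filterS => N /=.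
  by rewrite ger0_norm ?sumr_ge0//; apply: le_lt_trans; exact: ler_norm_sum.
have -> : series (fun t => u t.+1 - u t) = (fun N => u N - u 0%N).
  by apply/funext => N; rewrite /series/= telescope_sumr.
move=> /cvg_ex[l ul]; apply/cvg_ex; exists (l + u 0%N).
have uE : (fun N => (u N - u 0%N) + u 0%N) = u by apply/funext => N; rewrite subrK.
by rewrite -[X in X @ _]uE; apply: (cvgD ul); exact: cvg_cst.
Qed.

End FiniteLength.

(** * From the inequality to convergence *)

Section Summability.
Variable R : realType.

(** While s t > m, cancel d t in the two bounds on s t - s t.+1, and telescope.  If
s t = m then s is constant from there on and d vanishes. *)
Lemma kl_summable (s d : nat -> R) (V : R -> R) (e a b m : R) (T : nat) :
  0 < a -> 0 <= b -> 0 < e -> (forall t, 0 <= d t) ->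
  (forall t, a * d t ^+ 2 <= s t - s t.+1) -> (forall t, m <= s t) ->
  (forall u v, 0 <= u -> u <= v -> v < e -> V u <= V v) ->
  (forall t, (T <= t)%N -> s t - m < e) ->
  (forall t, (T <= t)%N -> 0 < s t - m ->
     s t - s t.+1 <= b * d t * (V (s t - m) - V (s t.+1 - m))) ->
  exists B, forall N, \sum_(0 <= t < N) d t <= B.
Proof.
move=> a0 b0 e0 d0 dec sm Vm se kl.
have snon t : s t.+1 <= s t.
  by rewrite -subr_ge0; apply: le_trans (dec t); rewrite mulr_ge0 ?sqr_ge0// ltW.
have step t : (T <= t)%N -> a * d t <= b * (V (s t - m) - V (s t.+1 - m)).
  move=> Tt; have V0 : 0 <= V (s t - m) - V (s t.+1 - m).
    rewrite subr_ge0; apply: Vm; last exact: se.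
      by rewrite subr_ge0.
    by rewrite lerD2r.
  have [->|dt0] := eqVneq (d t) 0; first by rewrite mulr0 mulr_ge0.
  have dt : 0 < d t by rewrite lt0r dt0 d0.
  have s0 : 0 < s t - m.
    rewrite subr_gt0; apply: (@le_lt_trans _ _ (s t.+1)) => //.
    rewrite -subr_gt0; apply: lt_le_trans (dec t).
    by rewrite mulr_gt0// exprn_gt0.
  have := le_trans (dec t) (kl t Tt s0).
  have -> : a * d t ^+ 2 = d t * (a * d t) by ring.
  have -> : b * d t * (V (s t - m) - V (s t.+1 - m)) =
    d t * (b * (V (s t - m) - V (s t.+1 - m))) by ring.
  by rewrite ler_pM2l.
have sum N : a * (\sum_(T <= t < T + N) d t) <= b * (V (s T - m) - V (s (T + N)%N - m)).
  elim: N => [|N ih].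
    by rewrite addn0 big_geq// subrr !mulr0.
  rewrite addnS big_nat_recr ?leq_addr//= mulrDr.
  have := step (T + N)%N (leq_addr _ _); lra.
exists (\sum_(0 <= t < T) d t + b * (V (s T - m) - V 0) / a) => N.
apply: (@le_trans _ _ (\sum_(0 <= t < T + N) d t)).
  rewrite addnC [leRHS](big_cat_nat (n := N)) ?leq_addr//= lerDl.
  by apply: sumr_ge0.
rewrite (big_cat_nat (n := T)) ?leq_addr//= lerD2l ler_pdivlMr// mulrC.
apply: le_trans (sum N) _; apply: ler_wpM2l => //.
have : V 0 <= V (s (T + N)%N - m); last by lra.
by apply: Vm; [|rewrite subr_ge0|apply: se; exact: leq_addr].
Qed.

Lemma compact_enorm_bound n (A : set 'rV[R]_n) : A !=set0 -> compact A ->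
  exists2 M, 0 <= M & forall u, A u -> enorm u <= M.
Proof.
move=> A0 cA.
have ce : continuous (fun u : 'rV[R]_n => enorm u).
  by apply: (@continuous_enorm _ _ _ id) => u.
have [c _ cmax] := compact_EVT_max A0 cA (continuous_subspaceT ce).
exists (enorm c); first exact: enorm_ge0.
by move=> u Au; apply: cmax; rewrite inE.
Qed.

End Summability.

Section Nonexpansive.
Variables (R : realType) (n : nat).
Implicit Types (C : set 'rV[R]_n) (u v : 'rV[R]_n).

(** Add up the variational inequalities at the two projections. *)
Lemma proj_nonexpansive C u v : C !=set0 -> closed C -> convex_set C ->
  enorm (proj C u - proj C v) <= enorm (u - v).
Proof.
move=> C0 clC cvxC.
have [Cp _] := proj_nearest u C0 clC; have [Cq _] := proj_nearest v C0 clC.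
have h1 := @proj_variational _ _ C u _ C0 clC cvxC Cq.
have h2 := @proj_variational _ _ C v _ C0 clC cvxC Cp.
move: h1 h2; move: (proj C u) (proj C v) => p q h1 h2.
rewrite -(@ler_pXn2r _ 2)// ?nnegrE ?enorm_ge0// !sqr_enorm.
have h : 0 <= dot (u - v - (p - q)) (p - q).
  have -> : u - v - (p - q) = (u - p) - (v - q).
    by apply/rowP => i; rewrite !mxE; ring.
  move: h1; rewrite -[q - p]opprB dotNr => h1.
  by rewrite (dotDl (u - p)) dotNl; lra.
have := dot_ge0 (u - v - (p - q)); move: h; move: (u - v) (p - q) => b a.
by rewrite !dotE (dotC a b); lra.
Qed.

End Nonexpansive.

Section MeritTriple.
Variables (R : realType) (n : nat) (C D : set 'rV[R]_n) (g : R).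

Definition meritT (w : 'rV[R]_(n + (n + n))) :=
  merit g (triple1 w) (triple2 w) (triple3 w).

Lemma polymap_meritT : polymap meritT.
Proof.
have h (f1 f2 : 'rV[R]_(n + (n + n)) -> 'rV[R]_n) : polymap f1 -> polymap f2 ->
    polymap (fun w : 'rV[R]_(n + (n + n)) => dot (f1 w - f2 w) (f1 w - f2 w)).
  by move=> p1 p2; apply: polymap_dot; exact: polymap_rowB.
rewrite /meritT /merit; refine (polymapD _ _); refine (polymapM _ _);
  try exact: polymap_cst; apply: h; [exact: polymap_triple2 | exact: polymap_triple1 |
  exact: polymap_triple2 | exact: polymap_triple3].
Qed.

Lemma continuous_meritT : continuous meritT.
Proof.
have h (f1 f2 : 'rV[R]_(n + (n + n)) -> 'rV[R]_n) :
    continuous f1 -> continuous f2 ->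
    continuous (fun w => dot (f1 w - f2 w) (f1 w - f2 w)).
  move=> c1 c2; apply: continuous_dot => w;
    by apply: continuousB; [exact: c1 | exact: c2].
have c1 := h _ _ (@continuous_triple2 R n) (@continuous_triple1 R n).
have c2 := h _ _ (@continuous_triple2 R n) (@continuous_triple3 R n).
move=> w; apply: (@continuousD _ _ _
  (fun w => g * dot (triple2 w - triple1 w) (triple2 w - triple1 w))
  (fun w => (1 - g) * dot (triple2 w - triple3 w) (triple2 w - triple3 w))).
- by apply: (@continuousM _ _ (fun=> g)); [exact: cst_continuous | exact: c1].
- by apply: (@continuousM _ _ (fun=> 1 - g)); [exact: cst_continuous | exact: c2].
Qed.

(** The intersection with a ball is compact; once the ball contains the iterates,
they still satisfy the slope condition, now against fewer competitors. *)
Definition feasible_box (M : R) : set 'rV[R]_(n + (n + n)) :=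
  [set w | [/\ C (triple1 w), D (triple2 w) & dot w w <= M]].

Lemma definable_feasible_box M : definable C -> definable D ->
  definable (feasible_box M).
Proof.
move=> dC dD; apply: (@definable_ext _ _ _ (fun w : 'rV[R]_(n + (n + n)) =>
  C (triple1 w) /\ (D (triple2 w) /\ dot w w <= M))).
  by move=> w; split=> [[? []]|[]].
definable_tac.
- by apply: (@definable_comp _ _ _ _ _ C _ dC); exact: polymap_triple1.
- by apply: (@definable_comp _ _ _ _ _ D _ dD); exact: polymap_triple2.
- apply: definable_le; last exact: polymap_cst.
  by apply: polymap_dot; exact: polymap_id.
Qed.

Lemma compact_feasible_box M : closed C -> closed D -> compact (feasible_box M).
Proof.
move=> clC clD; apply: bounded_closed_compact.
  exists (Num.sqrt M); split; first exact: num_real.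
  move=> B MB w [_ _ wM]; apply: le_trans (ltW MB); apply: le_trans (norm_le_enorm _) _.
  by rewrite ler_wsqrtr.
rewrite (_ : feasible_box M = @triple1 R n @^-1` C `&` @triple2 R n @^-1` D
    `&` [set w | dot w w <= M]).
  apply: closedI; first apply: closedI.
  - by apply: preimage_closed => // w _; exact: continuous_triple1.
  - by apply: preimage_closed => // w _; exact: continuous_triple2.
  - apply: closed_le_fun; last exact: cst_continuous.
    by apply: (@continuous_dot _ _ _ id id) => w.
by apply/seteqP; split=> w /= => [[]|[[]]].
Qed.

End MeritTriple.

Lemma cvg_dot (R : realType) (n : nat) (u v : nat -> 'rV[R]_n) (a b : 'rV[R]_n) :
  u @ \oo --> a -> v @ \oo --> b -> (fun t => dot (u t) (v t)) @ \oo --> dot a b.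
Proof.
move=> ua vb; apply: cvg_big => [|i _]; first exact: add_continuous.
have entry (f : nat -> 'rV[R]_n) (l : 'rV[R]_n) :
    f @ \oo --> l -> (fun t => f t 0 i) @ \oo --> l 0 i.
  move=> fl; apply: (@cvg_comp _ _ _ f (fun w : 'rV[R]_n => w 0 i) _ _ _ fl).
  exact: coord_continuous.
by apply: cvgM; exact: entry.
Qed.

Theorem corollary1 (R : realType) (n : nat) (C D : set 'rV[R]_n) (gamma : R)
    (x0 : 'rV[R]_n) (y z x : nat -> 'rV[R]_n) :
  C !=set0 -> closed C -> semialgebraic C ->
  D !=set0 -> closed D -> semialgebraic D ->
  convex_set C ->
  0 < gamma -> gamma < Num.sqrt (3 / 2) - 1 ->
  compact C \/ compact D ->
  DR_sequence C D gamma x0 y z x ->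
  exists ys zs xs : 'rV[R]_n,
    [/\ (fun t => (y t, z t, x t)) @ \oo --> (ys, zs, xs),
        zs = ys & stationary C D zs].
Proof.
move=> C0 clC /semialgebraic_definable dC D0 clD /semialgebraic_definable dD cvxC.
move=> g0 gsqrt cpt [_ DR]; set g := gamma in g0 gsqrt DR *.
have g2 : (1 + g) ^+ 2 < 3 / 2.
  rewrite -[ltRHS]sqr_sqrtr; last by lra.
  by rewrite ltr_pXn2r// ?nnegrE ?sqrtr_ge0//; lra.
(* 1 + 2 g <= (1 + g)^2 < 3 / 2. *)
have g14 : g < 1 / 4 by have := sqr_ge0 g; lra.
have g1 : g < 1 by lra.
have gg : 2 * g ^+ 2 <= 1.
  have : g ^+ 2 <= g * (1 / 4) by rewrite expr2 ler_wpM2l//; lra.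
  lra.
pose P t := proj C (x t); pose Y t := y t.+1; pose Z t := z t.+1.
have xS t : x t.+1 = x t + (Z t - Y t) by have [] := DR t.
have xY t : x t = Y t + g *: (Y t - P t).
  have [yE _ _] := DR t; rewrite /Y yE -/(P t); apply/rowP => i; rewrite !mxE.
  by field; lra.
have CP t : C (P t) by exact: (proj_nearest (x t) C0 clC).1.
have VI t c : C c -> dot (Y t - P t) (c - P t) <= 0.
  move=> Cc; have := @proj_variational _ _ C (x t) c C0 clC cvxC Cc; rewrite -/(P t).
  rewrite (_ : x t - P t = (1 + g) *: (Y t - P t)); last first.
    by rewrite {1}xY; apply/rowP => i; rewrite !mxE; ring.
  by rewrite dotZl pmulr_rle0//; lra.
have DZ t : D (Z t) by have [_ [DZ _] _] := DR t.
have opt t w : D w -> enorm (Y t - g *: (Y t - P t) - Z t) ^+ 2 <=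
    enorm (Y t - g *: (Y t - P t) - w) ^+ 2.
  move=> Dw; have [_ [_ /(_ w Dw) h] _] := DR t.
  have -> : Y t - g *: (Y t - P t) = 2 *: y t.+1 - x t.
    by rewrite [in RHS]xY; apply/rowP => i; rewrite !mxE; ring.
  exact: h.
have Zstep t : Z t = Y t.+1 + g *: ((Y t.+1 - P t.+1) - (Y t - P t)).
  have -> : Z t = x t.+1 - x t + Y t by rewrite xS [x t + _]addrC addrK subrK.
  by rewrite (xY t.+1) (xY t); apply/rowP => i; rewrite !mxE; ring.
pose W t := triple (P t) (Z t) (Y t); pose s t := merit g (P t) (Z t) (Y t).
pose d t := enorm (Z t - Y t).
have sW t : meritT g (W t) = s t.
  by rewrite /meritT /W; have [-> -> ->] := tripleK (P t) (Z t) (Y t).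
pose a := (1 - 2 * g ^+ 2) / (1 + g) ^+ 2.
have a0 : 0 < a by rewrite divr_gt0 ?exprn_gt0//; have := sqr_ge0 g; lra.
have dec t : a * d t ^+ 2 <= s t - s t.+1.
  rewrite mulrAC ler_pdivrMr ?exprn_gt0//; last by lra.
  rewrite sqr_enorm [leRHS]mulrC; apply: merit_decrease => //.
  - by apply: opt; exact: DZ.
  - by apply: VI; exact: CP.
  - by apply: VI; exact: CP.
clearbody a.
have s0 t : 0 <= s t.
  have [_] := merit_ge g0 g1 (P t) (Z t) (Y t); apply: le_trans.
  by rewrite mulr_ge0 ?sqr_ge0//; lra.
have sdec : nonincreasing_seq s.
  apply/nonincreasing_seqP => t; rewrite -subr_ge0; apply: le_trans (dec t).
  by rewrite mulr_ge0 ?sqr_ge0// ltW.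
have sle t : s t <= s 0%N by exact: sdec.
have slb : has_lbound (range s) by exists 0 => _ [t _ <-].
have scv := nonincreasing_cvgn sdec slb.
set m := inf _ in scv.
have sm t : m <= s t by apply: ge_inf => //; exists t.
(* The merit bounds |z - p| and |z - y|, so that one bounded component bounds
   the two others. *)
have [M hM] : exists M, forall t, dot (W t) (W t) <= M.
  pose r1 := Num.sqrt (s 0%N / g); pose r2 := Num.sqrt (s 0%N / (1 - g)).
  have g1' : 0 < 1 - g by lra.
  have r1P t : enorm (Z t - P t) <= r1.
    rewrite -(ger0_norm (enorm_ge0 _)) -sqrtr_sqr ler_wsqrtr// ler_pdivlMr// mulrC.
    by apply: le_trans (sle t); have [] := merit_ge g0 g1 (P t) (Z t) (Y t).
  have r2P t : enorm (Z t - Y t) <= r2.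
    rewrite -(ger0_norm (enorm_ge0 _)) -sqrtr_sqr ler_wsqrtr// ler_pdivlMr// mulrC.
    by apply: le_trans (sle t); have [] := merit_ge g0 g1 (P t) (Z t) (Y t).
  have [B B0 hB] : exists2 B, 0 <= B & forall t,
      [/\ enorm (P t) <= B, enorm (Z t) <= B & enorm (Y t) <= B].
    have r10 : 0 <= r1 by exact: sqrtr_ge0.
    have r20 : 0 <= r2 by exact: sqrtr_ge0.
    have PZ t : enorm (P t) <= enorm (Z t) + r1.
      have -> : P t = Z t - (Z t - P t) by rewrite opprB addrC subrK.
      by apply: le_trans (ler_enormD _ _) _; rewrite enormN lerD2l.
    have YZ t : enorm (Y t) <= enorm (Z t) + r2.
      have -> : Y t = Z t - (Z t - Y t) by rewrite opprB addrC subrK.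
      by apply: le_trans (ler_enormD _ _) _; rewrite enormN lerD2l.
    have ZP t : enorm (Z t) <= enorm (P t) + r1.
      have {1}-> : Z t = P t + (Z t - P t) by rewrite addrC subrK.
      by apply: le_trans (ler_enormD _ _) _; rewrite lerD2l.
    case: cpt => cpt.
      have [B B0 hB] := compact_enorm_bound C0 cpt.
      exists (B + r1 + r2); first by lra.
      move=> t; have := hB _ (CP t); have := PZ t; have := YZ t; have := ZP t.
      by move=> *; split; lra.
    have [B B0 hB] := compact_enorm_bound D0 cpt.
    exists (B + r1 + r2); first by lra.
    move=> t; have := hB _ (DZ t); have := PZ t; have := YZ t; have := ZP t.
    by move=> *; split; lra.
  exists (B ^+ 2 + B ^+ 2 + B ^+ 2) => t.
  rewrite dot_triple; have [-> -> ->] := tripleK (P t) (Z t) (Y t).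
  have [h1 h2 h3] := hB t; rewrite -!sqr_enorm.
  by rewrite !lerD// ler_pXn2r// nnegrE enorm_ge0.
pose A := feasible_box C D M.
have AW t : A (W t).
  have [WC WD _] := tripleK (P t) (Z t) (Y t).
  by split => //; [rewrite WC | rewrite WD].
have slope t : slope_le A (meritT g) 1 (W t) (2 * d t).
  move=> w [Cw Dw _]; rewrite sW /meritT.
  have := @merit_slope R n g g0 g1 (P t) (Z t) (Y t) (triple1 w) (triple2 w) (triple3 w)
    (VI t _ Cw) (opt t _ Dw).
  move=> /le_trans; apply.
  rewrite -/(d t) -addrA -[leRHS]addrA lerD2l.
  have [wC wD wE] : [/\ triple1 (w - W t) = triple1 w - P t,
      triple2 (w - W t) = triple2 w - Z t & triple3 (w - W t) = triple3 w - Y t].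
    have [WC WD WE] := tripleK (P t) (Z t) (Y t).
    split; [rewrite -[in RHS]WC|rewrite -[in RHS]WD|rewrite -[in RHS]WE];
      by apply/rowP => i; rewrite !mxE.
  have [] := enorm_parts (w - W t); rewrite wC wD wE => eC eD eE.
  apply: lerD; last by rewrite mul1r -sqr_enorm ler_pXn2r// nnegrE enorm_ge0.
  apply: ler_wpM2l; first by rewrite mulr_ge0// enorm_ge0.
  have h1 := ler_wpM2l (ltW g0) eC.
  have h2 : (1 - g) * enorm (triple3 w - Y t) <= (1 - g) * enorm (w - W t).
    by apply: ler_wpM2l => //; lra.
  by rewrite -[leRHS]mul1r; lra.
have [e e0 [V [Vm kl]]] := @kurdyka_inequality R _ A (meritT g) 1 m ler01
  (definable_feasible_box M dC dD) (compact_feasible_box clC clD)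
  (polymap_meritT n g) (@continuous_meritT R n g).
(* The drop a (d t)^2 is at most s t - m, so that d t is small as soon as the
   level is close to its limit m. *)
have [T hT] : exists T, forall t, (T <= t)%N -> s t - m < e /\ 2 * d t <= 1.
  pose c := Num.min e (a / 4).
  have c0 : m < m + c by rewrite ltrDl lt_min e0/= divr_gt0.
  have c1 : c <= e by rewrite ge_min lexx.
  have c2 : c <= a / 4 by rewrite ge_min lexx orbT.
  clearbody c.
  have [T _ hT] := cvgr_lt _ scv _ c0; exists T => t /hT /= stc.
  split; first by lra.
  have h2 : 0 <= 1 / 2 :> R by lra.
  have dh : d t <= 1 / 2.
    rewrite -(@ler_pXn2r _ 2)// ?nnegrE ?enorm_ge0//.
    rewrite -(ler_pM2l a0); apply: le_trans (dec t) _.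
    by have := sm t.+1; lra.
  by rewrite mulrC -ler_pdivlMr.
have d0 t : 0 <= d t by exact: enorm_ge0.
have [B hB] : exists B, forall N, \sum_(0 <= t < N) d t <= B.
  apply: (@kl_summable R s d V e a 2 m T) => //.
    by move=> t /hT[].
  move=> t Tt st0; have [ste dt1] := hT t Tt.
  have := kl (W t) (2 * d t) (s t.+1 - m) (AW t).
  rewrite sW (_ : s t - m - (s t.+1 - m) = s t - s t.+1); last by ring.
  apply => //.
  - by rewrite dt1 mulr_ge0.
  - by rewrite subr_ge0 sm lerD2r; apply: sdec.
  - by rewrite st0.
have xd t : enorm (x t.+1 - x t) <= d t.
  by rewrite xS [_ - x t]addrC addKr.
have /cvg_ex[xs xcv] : cvgn x := cvg_of_finite_length xd hB.
have Pd t : enorm (P t.+1 - P t) <= d t.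
  by apply: le_trans (xd t); exact: proj_nonexpansive.
have /cvg_ex[ps Pcv] : cvgn P := cvg_of_finite_length Pd hB.
have scale (k : R) (f : nat -> 'rV[R]_n) (l : 'rV[R]_n) :
    f @ \oo --> l -> (fun t => k *: f t) @ \oo --> k *: l.
  by move=> fl; exact: (cvgZl_tmp fl).
pose ys := (1 + g)^-1 *: (xs + g *: ps).
have Ycv : Y @ \oo --> ys.
  rewrite (_ : Y = fun t => (1 + g)^-1 *: (x t + g *: P t)); last first.
    by apply/funext => t; have [] := DR t.
  by apply: (scale); apply: cvgD => //; exact: scale.
have Zcv : Z @ \oo --> ys.
  rewrite (_ : Z = fun t => Y t + (x t.+1 - x t)); last first.
    by apply/funext => t; rewrite xS [x t + _ - _]addrC addKr addrC subrK.
  rewrite -[ys]addr0 -(subrr xs); apply: cvgD => //; apply: cvgB => //.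
  by rewrite (cvg_shiftS x).
exists ys, ys, xs; split=> //.
  have ycv : y @ \oo --> ys by rewrite -(cvg_shiftS y).
  have zcv : z @ \oo --> ys by rewrite -(cvg_shiftS z).
  exact: (cvg_pair (cvg_pair ycv zcv) xcv).
have Dys : D ys by apply: (closed_cvg D clD _ ys Zcv); exact: nearW.
split=> //.
have Cps : C ps by apply: (closed_cvg C clC _ ps Pcv); exact: nearW.
have projE : proj C ys = ps.
  apply: variational_proj => // c Cc.
  have cdot : (fun t => dot (Y t - P t) (c - P t)) @ \oo --> dot (ys - ps) (c - ps).
    apply: cvg_dot; first exact: cvgB.
    by apply: cvgB => //; exact: cvg_cst.
  apply: (closed_cvg [set r : R | r <= 0] (@closed_le R 0) _ _ cdot).
  by apply: nearW => t /=; exact: VI.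
exists (ps - ys); last by rewrite projE; apply/rowP => i; rewrite !mxE; ring.
have iD w : D w -> indicator D w = 0%E by move=> Dw; rewrite /indicator asboolT.
split; first by rewrite iD.
(* The residual of the minimization over D that defines Z t is a proximal
   normal; the factor g^-1 makes its limit ps - ys. *)
pose v t := g^-1 *: ((Y t - g *: (Y t - P t)) - Z t).
exists Z, v; split=> //.
- rewrite iD// (_ : (fun k => indicator D (Z k)) = fun=> 0%E); first exact: cvg_cst.
  by apply/funext => t; rewrite iD.
- rewrite (_ : ps - ys = g^-1 *: ((ys - g *: (ys - ps)) - ys)).
    by apply: (scale); apply: cvgB => //; apply: cvgB => //; apply: (scale); exact: cvgB.
  by apply/rowP => i; rewrite !mxE; field; lra.
move=> t; apply: (@proximal_frechet _ _ D (Z t) (v t) (g^-1 / 2)) => //.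
  by rewrite divr_ge0// invr_ge0 ltW.
move=> w Dw; rewrite dotZl -mulrA; apply: ler_wpM2l; first by rewrite invr_ge0 ltW.
have := opt t w Dw; rewrite !sqr_enorm.
set h := w - Z t.
rewrite (_ : _ - w = Y t - g *: (Y t - P t) - Z t - h); last first.
  by apply/rowP => i; rewrite !mxE; ring.
by rewrite !(dotDl _ (- h)) !(dotDr _ _ (- h)) !dotNl !dotNr (dotC h); lra.
Qed.
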